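(* Assume that (A1)–(A5) of the context hold, and let $\hat X_k^{j,N}$ be the backward Euler scheme described in the context. Then for any $1\le p<\lfloor\frac{q_0}{2}\rfloor$ and any $0<h\le h_2:=\min\{h_1,\frac{1}{p(a_1-a_2)}\}$, $$\sup_{1\le j\le N}\mathbb{E}\left[|\hat X_k^{j,N}|^{2p}\right]\le K_9\sup_{1\le j\le N}\mathbb{E}\left[1+|X_0^j|^{4p}\right]\le K_9\,\mathbb{E}\left[1+|X_0|^{4p}\right]\qquad(k\ge0),$$ where $K_9$ is a constant independent of $h,k,N$.
   Context: Notation. $|\cdot|$ and $\langle\cdot,\cdot\rangle$ are the Euclidean norm and inner product on $\mathbb{R}^d$; $\|B\|=\sqrt{\operatorname{trace}(BB^T)}$ is the Hilbert–Schmidt norm. $\mathcal{P}_2(\mathbb{R}^d)$ is the set of probability measures on $\mathbb{R}^d$ with finite second moment, $\mathcal{W}_2(\mu,\nu)$ is the $L^2$-Wasserstein distance, $\mathcal{W}_2(\mu):=(\int|x|^2\mu(dx))^{1/2}$, and $\delta_x$ is the Dirac measure at $x$. Data. On a complete filtered probability space $(\Omega,\mathcal F,(\mathcal F_t)_{t\ge0},\mathbb P)$ let $W$ be an $m$-dimensional Brownian motion and $X_0$ an $\mathcal{F}_0$-measurable $\mathbb{R}^d$-valued random variable independent of $W$; let $b:\mathbb{R}^d\times\mathcal{P}_2(\mathbb{R}^d)\to\mathbb{R}^d$, $\sigma:\mathbb{R}^d\times\mathcal{P}_2(\mathbb{R}^d)\to\mathbb{R}^{d\times m}$. Assumptions.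 (A1) There are constants $K_1>K_2\ge0$, $K_1>0$, such that for all $x,y\in\mathbb{R}^d$, $\mu,\nu\in\mathcal{P}_2(\mathbb{R}^d)$: $2\langle x-y,b(x,\mu)-b(y,\nu)\rangle+\|\sigma(x,\mu)-\sigma(y,\nu)\|^2\le -K_1|x-y|^2+K_2\mathcal{W}_2(\mu,\nu)^2$. (A2) There are constants $L_1>0$, $\kappa\ge1$ such that for all $x,y,\mu,\nu$: $|b(x,\mu)-b(y,\nu)|^2\le L_1[(1+|x|^{2\kappa-2}+|y|^{2\kappa-2})|x-y|^2+\mathcal{W}_2(\mu,\nu)^2]$. (A3) There are constants $L_2>0$ and $q_0\ge20$ with $\mathbb{E}[|X_0|^{2q_0}]<\infty$ and $|b(0,\delta_0)|\le L_2$. (A4) There are constants $a_1>a_2\ge0$, $q^*\ge 4q_0-2$, $C\ge0$ such that for all $x,\mu$: $2\langle x,b(x,\mu)\rangle+(q^*-1)\|\sigma(x,\mu)\|^2\le -a_1|x|^2+a_2\mathcal{W}_2(\mu)^2+C$. (A5) There is a constant $0<L_\sigma<\frac{a_1-a_2}{5(2q_0-1)}$ such that for all $x,y,\mu,\nu$: $\|\sigma(x,\mu)-\sigma(y,\nu)\|^2\le L_\sigma[|x-y|^2+\mathcal{W}_2(\mu,\nu)^2]$. Backward Euler scheme. For $N\ge1$ let $(W^j,X_0^j)$, $1\le j\le N$, be i.i.d. copies of $(W,X_0)$. Uniform step size $h=1/M$ ($M\ge1$), $t_k=kh$. $\hat X_0^{i,N}=X_0^i$ and, for $k\ge0$, $\hat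 X_{k+1}^{i,N}=\hat X_k^{i,N}+h\,b(\hat X_{k+1}^{i,N},\hat\mu_k^N)+\sigma(\hat X_k^{i,N},\hat\mu_k^N)(W^i_{t_{k+1}}-W^i_{t_k})$ with $\hat\mu_k^N=\frac1N\sum_{j=1}^N\delta_{\hat X_k^{j,N}}$. Step-size bound. $h_1:=\min\{\frac{1}{2(K_1-K_2)},h_0\}$, where $h_0\in(0,1]$ is a fixed constant. *)

(* Defs.v *)
From HB Require Import structures.
From mathcomp Require Import all_boot all_order all_algebra.
From mathcomp Require Import all_classical all_reals all_analysis.
From mathcomp Require Import measurable_realfun.

Set Implicit Arguments.
Unset Strict Implicit.
Unset Printing Implicit Defensive.

Import Order.TTheory GRing.Theory Num.Theory.
Import numFieldNormedType.Exports.

Local Open Scope classical_set_scope.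
Local Open Scope ring_scope.

Section Euclidean.
Context {R : realType}.

Definition inner {d} (x y : 'cV[R]_d) : R := \sum_i x i ord0 * y i ord0.

(* Not `|x|: the library norm on matrices is the sup norm. *)
Definition enorm {d} (x : 'cV[R]_d) : R := Num.sqrt (inner x x).

Definition hsnorm {d m} (B : 'M[R]_(d, m)) : R := Num.sqrt (\tr (B *m B^T)).

Lemma inner_ge0 {d} (x : 'cV[R]_d) : 0 <= inner x x.
Proof. by apply: sumr_ge0 => i _; rewrite -expr2 sqr_ge0. Qed.

Lemma enorm_ge0 {d} (x : 'cV[R]_d) : 0 <= enorm x.
Proof. exact: sqrtr_ge0. Qed.

Lemma sqr_enorm {d} (x : 'cV[R]_d) : enorm x ^+ 2 = inner x x.
Proof. by rewrite sqr_sqrtr ?inner_ge0. Qed.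

End Euclidean.

(* 'cV[R]_d with its Borel sigma-algebra. *)
Definition borelV (R : realType) (d : nat) :=
  g_sigma_algebraType (@open 'cV[R]_d).

Section BorelV.
Context {R : realType} {d : nat}.

Lemma measurable_coord (i : 'I_d) :
  measurable_fun [set: borelV R d] (fun x : 'cV[R]_d => x i ord0).
Proof.
apply: (measurability _ (RGenOpens.measurableE R)).
move=> _ [_ [a [b ->]] <-]; apply: sub_sigma_algebra; rewrite setTI.
apply: open_comp; last exact: interval_open.
by move=> x _; exact: coord_continuous.
Qed.

Lemma measurable_sqr_enorm :
  measurable_fun [set: borelV R d] (fun x : 'cV[R]_d => enorm x ^+ 2).
Proof.
under eq_fun do rewrite sqr_enorm.
by apply: measurable_sum => i; apply: measurable_funM; exact: measurable_coord.
Qed.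

End BorelV.

Section Wasserstein.
Context {R : realType} {d : nat}.
Local Open Scope ereal_scope.

Record P2 := MkP2 {
  P2_prob :> probability (borelV R d) R;
  P2_fin : \int[P2_prob]_x (enorm x ^+ 2)%:E < +oo }.

Definition coupling (mu nu : P2)
    (pi : probability (borelV R d * borelV R d)%type R) : Prop :=
  (forall A : set (borelV R d), measurable A -> pi (A `*` setT) = mu A) /\
  (forall A : set (borelV R d), measurable A -> pi (setT `*` A) = nu A).

Definition wasserstein2 (mu nu : P2) : R :=
  Num.sqrt (fine (ereal_inf
    [set \int[pi]_z (enorm (z.1 - z.2)%R ^+ 2)%:E | pi in coupling mu nu])).

Definition moment2 (mu : P2) : R :=
  Num.sqrt (fine (\int[mu]_x (enorm x ^+ 2)%:E)).

Lemma dirac_P2_fin (a : 'cV[R]_d) :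
  \int[\d_(a : borelV R d)]_x (enorm x ^+ 2)%:E < +oo.
Proof.
rewrite integral_dirac//; last first.
  by apply/measurable_EFinP; exact: measurable_sqr_enorm.
by rewrite diracT mul1e ltry.
Qed.

Definition dirac_P2 (a : 'cV[R]_d) : P2 :=
  @MkP2 (\d_(a : borelV R d)) (dirac_P2_fin a).

(* Particles are indexed by 'I_N.+1, so that there is at least one; msum sums
   over nat indices, hence inord. *)
Section Empirical.
Context {N : nat} (x : 'I_N.+1 -> 'cV[R]_d).

Definition empirical : set (borelV R d) -> \bar R :=
  mscale ((N.+1%:R^-1 : R)%:nng)%R
    (msum (fun j : nat => \d_(x (inord j) : borelV R d)) N.+1).

HB.instance Definition _ := Measure.on empirical.

Lemma empirical_setT : empirical setT = 1.
Proof.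
rewrite /empirical /mscale /= /msum/=.
under eq_bigr do rewrite diracT.
by rewrite sumEFin big_const_ord iter_addr_0 -EFinM mulVf// pnatr_eq0.
Qed.

HB.instance Definition _ :=
  Measure_isProbability.Build _ _ _ empirical empirical_setT.

Lemma empirical_P2_fin : \int[empirical]_y (enorm y ^+ 2)%:E < +oo.
Proof.
have mf : measurable_fun [set: borelV R d]
    (fun y : 'cV[R]_d => (enorm y ^+ 2)%:E).
  by apply/measurable_EFinP; exact: measurable_sqr_enorm.
have f0 (y : 'cV[R]_d) : 0 <= (enorm y ^+ 2)%:E by rewrite lee_fin sqr_ge0.
rewrite ge0_integral_mscale// ge0_integral_measure_sum//.
under eq_bigr do rewrite integral_dirac// diracT mul1e.
by rewrite sumEFin -EFinM ltry.
Qed.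

Definition empirical_P2 : P2 := @MkP2 empirical empirical_P2_fin.

End Empirical.

End Wasserstein.
Arguments P2 : clear implicits.

Section Assumptions.
Context {R : realType} {d m : nat}.
Variables (b : 'cV[R]_d -> P2 R d -> 'cV[R]_d)
  (sigma : 'cV[R]_d -> P2 R d -> 'M[R]_(d, m)).

Definition A1 (K1 K2 : R) : Prop :=
  [/\ 0 <= K2, K2 < K1, 0 < K1 &
  forall x y mu nu,
    2 * inner (x - y) (b x mu - b y nu)
      + hsnorm (sigma x mu - sigma y nu) ^+ 2
    <= - K1 * enorm (x - y) ^+ 2 + K2 * wasserstein2 mu nu ^+ 2].

(* powR has 0 `^ 0 = 1, as needed when kappa = 1. *)
Definition A2 (L1 kappa : R) : Prop :=
  [/\ 0 < L1, 1 <= kappa &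
  forall x y mu nu,
    enorm (b x mu - b y nu) ^+ 2
    <= L1 * ((1 + enorm x `^ (2 * kappa - 2) + enorm y `^ (2 * kappa - 2))
               * enorm (x - y) ^+ 2 + wasserstein2 mu nu ^+ 2)].

Definition A3 disp (T : measurableType disp) (P : probability T R)
    (X0 : T -> borelV R d) (L2 q0 : R) : Prop :=
  [/\ 0 < L2, 20 <= q0,
      ('E_P[fun w => (enorm (X0 w) `^ (2 * q0))%R] < +oo)%E &
      enorm (b 0 (dirac_P2 0)) <= L2].

Definition A4 (q0 a1 a2 qstar C : R) : Prop :=
  [/\ [/\ 0 <= a2, a2 < a1, 4 * q0 - 2 <= qstar & 0 <= C] &
  forall x mu,
    2 * inner x (b x mu) + (qstar - 1) * hsnorm (sigma x mu) ^+ 2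
    <= - a1 * enorm x ^+ 2 + a2 * moment2 mu ^+ 2 + C].

Definition A5 (q0 a1 a2 Lsigma : R) : Prop :=
  [/\ 0 < Lsigma, Lsigma < (a1 - a2) / (5 * (2 * q0 - 1)) &
  forall x y mu nu,
    hsnorm (sigma x mu - sigma y nu) ^+ 2
    <= Lsigma * (enorm (x - y) ^+ 2 + wasserstein2 mu nu ^+ 2)].

End Assumptions.

(* Functions of time with the sigma-algebra generated by the evaluations at
   times t >= 0; values at negative times are irrelevant. *)
Definition cylinder (R : realType) (m : nat) : set (set (R -> 'cV[R]_m)) :=
  [set C | exists t (B : set (borelV R m)),
     [/\ 0 <= t, measurable B & C = [set w | B (w t)]]].

Definition pathV (R : realType) (m : nat) :=
  g_sigma_algebraType (@cylinder R m).

Section Probability.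
Context {R : realType} {disp : measure_display} {T : measurableType disp}.
Variable P : probability T R.

Definition complete_filtration (F : R -> set (set T)) : Prop :=
  [/\ measure_is_complete P,
      forall t, 0 <= t -> sigma_algebra setT (F t) /\ F t `<=` measurable,
      forall s t, 0 <= s -> s <= t -> F s `<=` F t &
      P.-negligible `<=` F 0].

Definition F_measurable d (G : set (set T)) (X : T -> borelV R d) : Prop :=
  forall B : set (borelV R d), measurable B -> G (X @^-1` B).

Definition increment m (W : T -> pathV R m) (s t : R) (w : T) : borelV R m :=
  W w t - W w s.

Definition brownian_motion m (F : R -> set (set T)) (W : T -> pathV R m) :
    Prop :=
  [/\ {ae P, forall w, W w 0 = 0},
      {ae P, forall w, {within `[0, +oo[, continuous (W w : R -> 'cV[R]_m)}},
      forall t, 0 <= t -> F_measurable (F t) (fun w => W w t),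
      forall s t, 0 <= s -> s < t ->
        forall (A : set T) (B : set (borelV R m)), F s A -> measurable B ->
        (P (A `&` increment W s t @^-1` B)
         = P A * P (increment W s t @^-1` B))%E &
      forall s t, 0 <= s -> s < t ->
        forall A : 'I_m -> set R, (forall i, measurable (A i)) ->
        (P [set w | forall i, A i (increment W s t w i ord0)]
         = \prod_(i < m) normal_prob 0 (Num.sqrt (t - s)) (A i))%E].

Definition independent d1 d2 (S1 : measurableType d1) (S2 : measurableType d2)
    (X : T -> S1) (Y : T -> S2) : Prop :=
  forall (A : set S1) (B : set S2), measurable A -> measurable B ->
    (P (X @^-1` A `&` Y @^-1` B) = P (X @^-1` A) * P (Y @^-1` B))%E.

Definition iid_copies d' (S : measurableType d') (Z : T -> S) n
    (Zc : 'I_n -> T -> S) : Prop :=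
  [/\ forall j, measurable_fun setT (Zc j),
      forall j (A : set S), measurable A -> P (Zc j @^-1` A) = P (Z @^-1` A) &
      forall A : 'I_n -> set S, (forall j, measurable (A j)) ->
        (P (\bigcap_(j in setT) (Zc j @^-1` A j))
         = \prod_(j < n) P (Zc j @^-1` A j))%E].

Definition backward_euler d m (b : 'cV[R]_d -> P2 R d -> 'cV[R]_d)
    (sigma : 'cV[R]_d -> P2 R d -> 'M[R]_(d, m)) (h : R) N
    (W : 'I_N.+1 -> T -> pathV R m) (X0 : 'I_N.+1 -> T -> borelV R d)
    (X : nat -> 'I_N.+1 -> T -> borelV R d) : Prop :=
  [/\ forall k i, measurable_fun setT (X k i),
      forall i, {ae P, forall w, X 0%N i w = X0 i w} &
      forall k i, {ae P, forall w,
        let mu := empirical_P2 (fun j => X k j w) in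
        (X k.+1 i w : 'cV[R]_d) =
          X k i w + h *: b (X k.+1 i w) mu
          + sigma (X k i w) mu
              *m increment (W i) (k%:R * h) (k.+1%:R * h) w}].

End Probability.

Definition h1 (R : realType) (K1 K2 h0 : R) : R :=
  Num.min (2 * (K1 - K2))^-1 h0.

Definition h2 (R : realType) (K1 K2 h0 a1 a2 p : R) : R :=
  Num.min (h1 K1 K2 h0) (p * (a1 - a2))^-1.

(* Main.v *)
Require Import Defs.
From HB Require Import structures.
From mathcomp Require Import all_boot all_order all_algebra.
From mathcomp Require Import all_classical all_reals all_analysis.
From mathcomp Require Import measurable_realfun.
From mathcomp Require Import ring lra.

Set Implicit Arguments.
Unset Strict Implicit.
Unset Printing Implicit Defensive.

Import Order.TTheory GRing.Theory Num.Theory.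
Import numFieldNormedType.Exports.

Local Open Scope classical_set_scope.
Local Open Scope ring_scope.

(** A backward Euler step moves the state X of a particle by the implicit
    equation X' - h b(X', mu) = X + sigma(X, mu) dW, where mu is the empirical
    measure of the particles. Two effects compete. By (A4) the map
    x |-> x - h b(x, mu) expands squared norms:
      (1 + a1 h) |X'|^2 <= |X + sigma dW|^2 + a2 h S + C h,
    where S is the mean square of the particles ([implicit_step_dissipation]).
    On the other hand the noise spreads the explicit part. Let n be the ceiling
    of p. Since dW is a centred Gaussian vector independent of the past,
      E (|X + sigma dW|^2 + r)^n
        <= E (|X|^2 + (2n - 1) h ||sigma||^2 + r)^n
    for every nonnegative r known before the step
    ([expectation_gaussian_vector]). This is the sharp hypercontractive constant,
    with no correction of higher order in h; it comes from the Gaussian moments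
    and from a comparison of binomial coefficients
    ([gaussian_quadratic_moment]). By (A5) the square of sigma grows at most like
    2 Lsigma (|X|^2 + S), and Lsigma is so small that (2n - 1) 2 Lsigma, counted
    once for |X|^2 and once for S, is less than a1 - a2.

    Dividing by 1 + a1 h therefore presents |X'|^2 as a convex combination of
    |X|^2, of S and of a fixed level G. Convexity of the n-th power shows that a
    bound B >= G^n on the moments of order 2n of all particles at one step is
    still a bound at the next one ([moment_step]), without any loss that could
    accumulate over time. Starting from B = E |X0|^(2n) + G^n, and with
    p <= n <= 2p, this bounds the moments of order 2p by
    (2 + G^n) E (1 + |X0|^(4p)).

    The Gaussian estimate needs the state at time k h to be independent of the
    next increment, although the scheme is given only as a family of random
    variables that solve the equation almost surely. The past of the copies of
    (W, X0) is described by a pi-system that contains the null sets and is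
    independent of the next increments ([increment_copies_independent]). The
    scheme is measurable for this past ([measurable_particle]): by (A1) the
    distance of a point to the solution of the implicit equation is at most its
    residual, so the solution is found by testing rational points
    ([measurable_implicit]), and the residual is measurable because, by (A2) and
    (A5), the coefficients depend continuously on the positions of the
    particles. *)

(** * Euclidean and Hilbert-Schmidt norms *)

Section inner_product.
Context {R : realType} {d : nat}.
Implicit Types x y z : 'cV[R]_d.

Lemma innerC x y : inner x y = inner y x.
Proof. by apply: eq_bigr => i _; rewrite mulrC. Qed.

Lemma innerDl x y z : inner (x + y) z = inner x z + inner y z.
Proof. by rewrite -big_split; apply: eq_bigr => i _; rewrite mxE mulrDl. Qed.

Lemma innerZl (a : R) x y : inner (a *: x) y = a * inner x y.
Proof. by rewrite mulr_sumr; apply: eq_bigr => i _; rewrite mxE mulrA. Qed.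

Lemma innerDr x y z : inner x (y + z) = inner x y + inner x z.
Proof. by rewrite innerC innerDl !(innerC x). Qed.

Lemma innerZr (a : R) x y : inner x (a *: y) = a * inner x y.
Proof. by rewrite innerC innerZl innerC. Qed.

(** By Lagrange's identity the defect is the sum of the squares of the
    two-by-two minors of x and y. *)
Lemma cauchy_schwarz x y : inner x y ^+ 2 <= inner x x * inner y y.
Proof.
suff : 0 <= 2 * (inner x x * inner y y - inner x y ^+ 2).
  by rewrite pmulr_rge0// subr_ge0.
have -> : 2 * (inner x x * inner y y - inner x y ^+ 2) =
  \sum_i \sum_j (x i ord0 * y j ord0 - x j ord0 * y i ord0) ^+ 2.
  rewrite mulrBr mulr2n mulrDl !mul1r {2}[inner x x * _]mulrC expr2 /inner.
  rewrite !mulr_suml mulr_sumr -big_split -sumrB; apply: eq_bigr => i _ /=.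
  rewrite !mulr_sumr -big_split -sumrB; apply: eq_bigr => j _ /=.
  ring.
by apply: sumr_ge0 => i _; apply: sumr_ge0 => j _; exact: sqr_ge0.
Qed.

Lemma sqr_enormD x y (t : R) :
  enorm (x + t *: y) ^+ 2 =
  enorm x ^+ 2 + 2 * inner x y * t + enorm y ^+ 2 * t ^+ 2.
Proof.
by rewrite !sqr_enorm !(innerDl, innerDr, innerZl, innerZr) (innerC y x); ring.
Qed.

End inner_product.

(** The column-by-column form is the one that meets a noise whose coordinates
    are treated one at a time. *)
Lemma sqr_hsnorm {R : realType} {d m : nat} (B : 'M[R]_(d, m)) :
  hsnorm B ^+ 2 = \sum_l \sum_c B c l ^+ 2.
Proof.
have -> : \sum_l \sum_c B c l ^+ 2 = \tr (B *m B^T).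
  rewrite exchange_big; apply: eq_bigr => c _; rewrite mxE.
  by apply: eq_bigr => l _; rewrite mxE expr2.
rewrite /hsnorm sqr_sqrtr// /mxtrace; apply: sumr_ge0 => c _; rewrite mxE.
by apply: sumr_ge0 => l _; rewrite mxE -expr2 sqr_ge0.
Qed.

(** * Gaussian moments *)

Section gaussian_integrals.
Context {R : realType}.
Local Notation mu := lebesgue_measure.

(** Lebesgue measure is determined by its values on half-open intervals, and
    reflection preserves these values. *)
Lemma ge0_integral_lebesgue_opp (f : R -> \bar R) :
  measurable_fun setT f -> (forall x, 0 <= f x)%E ->
  (\int[mu]_x f (- x)%R = \int[mu]_x f x)%E.
Proof.
move=> mf f0.
have mopp : measurable_fun [set: measurableTypeR R]
    (-%R : measurableTypeR R -> measurableTypeR R) by exact: measurable_funN.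
have := ge0_integral_pushforward mopp
  (lebesgue_measure : {measure set (measurableTypeR R) -> \bar R})
  measurableT mf (fun y _ => f0 y).
rewrite preimage_setT => <-; apply: eq_measure_integral => A mA _.
apply/esym/lebesgue_measure_unique => //.
move=> X [[a b] /= _ <-].
rewrite /pushforward.
have -> : -%R @^-1` `]a, b] = `[- b, - a[%classic.
  by apply/seteqP; split => x /=; rewrite !in_itv/= lerNl ltrNr andbC.
rewrite lebesgue_measure_itv /=.
rewrite !lebesgue_measure_itv /= !lte_fin ltrN2; case: ifP => // _.
by rewrite -!EFinD opprK addrC.
Qed.

(** The Gaussian law is defined by its values on sets, so the integral of a
    function comes from the change of variables for Radon-Nikodym derivatives:
    the derivative agrees almost everywhere with the explicit density. *)
Lemma ge0_integral_normal_prob (s : R) (f : R -> \bar R) :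
  measurable_fun setT f -> (forall x, 0 <= f x)%E ->
  (\int[normal_prob 0 s]_x f x = \int[mu]_x (f x * (normal_pdf 0 s x)%:E))%E.
Proof.
move=> mf f0.
have dom := normal_prob_dominates (0 : R) s.
rewrite -(Radon_Nikodym_SigmaFinite.change_of_variables dom f0 measurableT mf).
have mpdf : measurable_fun setT (fun x => (normal_pdf 0 s x)%:E).
  by apply/measurable_EFinP; exact: measurable_normal_pdf.
have ipdf := integrable_normal_pdf (0 : R) s.
have mRN := measurable_int _ (Radon_Nikodym_SigmaFinite.f_integrable dom).
apply: ge0_ae_eq_integral => //.
- exact: emeasurable_funM.
- exact: emeasurable_funM.
- by move=> x _; rewrite mule_ge0// Radon_Nikodym_SigmaFinite.f_ge0.
- by move=> x _; rewrite mule_ge0// lee_fin normal_pdf_ge0.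
- apply: ae_eqe_mul2l; apply: integral_ae_eq => //.
    exact: Radon_Nikodym_SigmaFinite.f_integrable.
  move=> A _ mA; rewrite -Radon_Nikodym_SigmaFinite.f_integral//.
Qed.

Lemma measurable_even_moment (s : R) (j : nat) (D : set (measurableTypeR R)) :
  measurable_fun D (fun x : R => (x ^+ j * normal_pdf 0 s x)%:E).
Proof.
apply: measurable_funTS; apply/measurable_EFinP; apply: measurable_funM.
  exact: exprn_measurable.
exact: measurable_normal_pdf.
Qed.

Lemma derivable_normal_pdf (s x : R) : s != 0 ->
  is_derive x 1 (normal_pdf 0 s) (- (x / s ^+ 2) * normal_pdf 0 s x).
Proof.
move=> s0; rewrite normal_pdfE//.
pose g (y : R) := - (y - 0) ^+ 2 / (s ^+ 2 *+ 2).
rewrite (_ : (fun x : R => _) = normal_peak s *: (expR \o g)); last exact/funext.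
have dg : is_derive x 1 g (- (x / s ^+ 2)).
  have -> : g = (fun y => - (s ^+ 2 *+ 2)^-1 * (y ^+ 2)).
    by apply/funext => y; rewrite /g subr0 mulrC mulNr mulrN.
  apply: is_derive_eq.
  rewrite scaler1 -mulr2n -[s ^+ 2 *+ 2]mulr_natr -[x *+ 2]mulr_natr scaleNr.
  by congr (- _); rewrite /GRing.scale/=; field.
have de := is_derive1_comp (is_derive_expR (g x)) dg.
apply: is_derive_eq.
rewrite -[normal_fun 0 s x]/(expR (g x)) /GRing.scale/=; ring.
Qed.

Lemma derivable_oo_LRcontinuous_is_derive (F f : R -> R) (a b : R) :
  (forall x : R, is_derive x 1 F (f x)) ->
  derivable_oo_LRcontinuous F a b /\ F^`()%classic =1 f.
Proof.
move=> Ff; have cF x : {for x, continuous F}.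
  by apply/differentiable_continuous/derivable1_diffP.
split; last by move=> x; rewrite derive1E derive_val.
split=> [x _//||]; first exact/cvg_at_right_filter/cF.
exact/cvg_at_left_filter/cF.
Qed.

(** Integration by parts from x^(2j+1) and from - s^2 phi, a primitive of
    x phi, where phi is the density; the boundary terms have the favourable
    sign. *)
Lemma truncated_even_moment (s : R) (j : nat) (A : R) : s != 0 -> 0 < A ->
  (\int[mu]_(x in `[(- A)%R, A]) (x ^+ (2 * j.+1) * normal_pdf 0 s x)%:E
   <= ((2 * j).+1%:R * s ^+ 2)%:E *
      \int[mu]_(x in `[(- A)%R, A]) (x ^+ (2 * j) * normal_pdf 0 s x)%:E)%E.
Proof.
move=> s0 A0.
pose F (x : R) := x ^+ (2 * j).+1.
pose f (x : R) := (2 * j).+1%:R * x ^+ (2 * j).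
pose G (x : R) := - s ^+ 2 * normal_pdf 0 s x.
pose g (x : R) := x * normal_pdf 0 s x.
have dF (x : R) : is_derive x 1 F (f x).
  have -> : F = (id : R -> R) ^+ (2 * j).+1.
    by apply/funext => y; rewrite exprfctE.
  apply: is_derive_eq (is_deriveX _ (is_derive_id _ _)) _.
  by rewrite /GRing.scale/= mulr1.
have dG (x : R) : is_derive x 1 G (g x).
  have := derivable_normal_pdf x s0 => dp.
  rewrite /G; apply: is_derive_eq.
  by rewrite /GRing.scale/= /g; field.
have cn n : continuous (fun x : R => x ^+ n) by exact: exprn_continuous.
have cf : continuous f.
  by move=> x; apply: cvgM; [exact: cvg_cst|exact: cn].
have cg : continuous g.
  by move=> x; apply: cvgM; [exact: cvg_id|exact: continuous_normal_pdf].
have [FLR F'] := derivable_oo_LRcontinuous_is_derive (- A) A dF.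
have [GLR G'] := derivable_oo_LRcontinuous_is_derive (- A) A dG.
have AA : - A < A by lra.
have := integration_by_parts AA (continuous_subspaceT cf) FLR (fun x _ => F' x)
  (continuous_subspaceT cg) GLR (fun x _ => G' x).
rewrite (_ : (\int[mu]_(x in `[(- A)%R, A]) (F x * g x)%:E
    = \int[mu]_(x in `[(- A)%R, A]) (x ^+ (2 * j.+1) * normal_pdf 0 s x)%:E)%E);
  last by apply: eq_integral => x _; rewrite /F /g mulrA -exprSr mulnS.
move=> ->.
rewrite (_ : (\int[mu]_(x in `[(- A)%R, A]) (f x * G x)%:E
    = (- ((2 * j).+1%:R * s ^+ 2))%:E *
      \int[mu]_(x in `[(- A)%R, A]) (x ^+ (2 * j) * normal_pdf 0 s x)%:E)%E);
    last first.
  rewrite -integralZl//; last first.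
    apply: continuous_compact_integrable; first exact: segment_compact.
    apply: continuous_subspaceT => x; apply: cvgM; first exact: cn.
    exact: continuous_normal_pdf.
  by apply: eq_integral => x _; rewrite /f /G -EFinM; congr EFin; ring.
rewrite EFinN mulNe oppeK -[leRHS]add0e; apply: leeD2r; rewrite lee_fin.
have -> : F (- A) = - F A by rewrite /F exprNn -signr_odd oddS oddM/= mulN1r.
have -> : G (- A) = G A by rewrite /G !normal_pdfE// /normal_fun !subr0 sqrrN.
rewrite mulNr opprK -mulr2n -mulr_natr mulr_le0_ge0//.
rewrite /G mulNr mulrN oppr_le0 mulr_ge0//.
  by rewrite /F exprn_ge0// ltW.
by rewrite mulr_ge0 ?normal_pdf_ge0// sqr_ge0.
Qed.

(** Monotone convergence along the symmetric intervals turns the truncated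
    inequality into one for the full integrals. *)
Lemma even_moment_succ (s : R) (j : nat) : s != 0 ->
  (\int[mu]_x (x ^+ (2 * j.+1) * normal_pdf 0 s x)%:E
   <= ((2 * j).+1%:R * s ^+ 2)%:E *
      \int[mu]_x (x ^+ (2 * j) * normal_pdf 0 s x)%:E)%E.
Proof.
move=> s0.
pose I (k : nat) : set (measurableTypeR R) := `[(- k.+1%:R)%R, k.+1%:R]%classic.
have UI : \bigcup_k I k = setT.
  apply/seteqP; split => // x _; exists (Num.trunc `|x|) => //.
  by rewrite /I/= in_itv/= -ler_norml ltW// truncnS_gt.
have ge0 n (x : R) : (0 <= (x ^+ (2 * n) * normal_pdf 0 s x)%:E)%E.
  by rewrite lee_fin mulr_ge0 ?normal_pdf_ge0// exprM exprn_ge0 ?sqr_ge0.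
have mI k : measurable (I k) by exact: measurable_itv.
have cvgI := @ge0_nondecreasing_set_cvg_integral _ _ _ I
  (fun x : R => (x ^+ (2 * j.+1) * normal_pdf 0 s x)%:E) lebesgue_measure.
have {cvgI} : (\int[mu]_(x in I i) (x ^+ (2 * j.+1) * normal_pdf 0 s x)%:E
    @[i --> \oo] --> \int[mu]_x (x ^+ (2 * j.+1) * normal_pdf 0 s x)%:E)%E.
  rewrite -UI; apply: cvgI => //.
  - move=> a c ac; apply/subsetPset => x; rewrite /I/= !in_itv/= -!ler_norml.
    by move=> /le_trans; apply; rewrite ler_nat ltnS.
  - by move=> i; exact: measurable_even_moment.
move=> cvgI; rewrite -(cvg_lim _ cvgI)//; apply: lime_le.
  by apply/cvg_ex; eexists; exact: cvgI.
apply: nearW => k; apply: (le_trans (truncated_even_moment j s0 _)) => //.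
rewrite lee_pmul2l//; last by rewrite lte_fin mulr_gt0// exprn_even_gt0.
apply: ge0_subset_integral => //; exact: measurable_even_moment.
Qed.

(** The product is (2j-1)!!, so that this is one half of the formula for the
    Gaussian moments. *)
Lemma even_moment_le (s : R) (j : nat) : s != 0 ->
  (\int[normal_prob 0 s]_x (x ^+ (2 * j))%:E
   <= (\prod_(i < j) (2 * i).+1%:R * s ^+ (2 * j))%:E)%E.
Proof.
move=> s0; rewrite ge0_integral_normal_prob//; last 2 first.
- by apply/measurable_EFinP; exact: exprn_measurable.
- by move=> x; rewrite lee_fin exprM exprn_ge0 ?sqr_ge0.
under eq_integral do rewrite -EFinM.
elim: j => [|j IH].
  rewrite big_ord0 mul1r !expr0.
  under eq_integral do rewrite mul1r.
  by rewrite integral_normal_pdf.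
apply: (le_trans (even_moment_succ j s0)).
apply: (@le_trans _ _ (((2 * j).+1%:R * s ^+ 2)%:E *
    (\prod_(i < j) (2 * i).+1%:R * s ^+ (2 * j))%:E)%E).
  by rewrite lee_pmul2l// lte_fin mulr_gt0// exprn_even_gt0.
rewrite -EFinM lee_fin big_ord_recr/= mulnS exprD.
by rewrite le_eqVlt; apply/orP; left; apply/eqP; ring.
Qed.

End gaussian_integrals.

(** * Binomial inequalities *)

Section symmetrised_powers.
Context {R : realDomainType}.

(** Write S_n for the sum and D_n = e ((A+e)^n - (A-e)^n). Then
    S_(n+1) = A S_n + D_n and D_(n+1) = e^2 S_n + A D_n, a recursion with
    nonnegative coefficients that sees e only through e^2. *)
Lemma symmetrised_power_le (A e f : R) n : 0 <= A -> e ^+ 2 <= f ^+ 2 ->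
  (A + e) ^+ n + (A - e) ^+ n <= (A + f) ^+ n + (A - f) ^+ n.
Proof.
move=> A0 ef.
pose S (x : R) k := (A + x) ^+ k + (A - x) ^+ k.
pose D (x : R) k := x * ((A + x) ^+ k - (A - x) ^+ k).
have SS x k : S x k.+1 = A * S x k + D x k by rewrite /S /D !exprS; ring.
have DS x k : D x k.+1 = x ^+ 2 * S x k + A * D x k.
  by rewrite /S /D !exprS; ring.
have SD0 k : 0 <= S e k /\ 0 <= D e k.
  elim: k => [|k [S0 D0]]; first by rewrite /S /D !expr0 subrr mulr0; split.
  by rewrite SS DS; split; rewrite addr_ge0// mulr_ge0// sqr_ge0.
suff : S e n <= S f n /\ D e n <= D f n by case.
elim: n => [|n [IS ID]]; first by rewrite /S /D !expr0 !subrr !mulr0.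
rewrite !SS !DS; have [S0 D0] := SD0 n.
split; apply: lerD => //; first exact: ler_wpM2l.
  by apply: ler_pM => //; exact: sqr_ge0.
exact: ler_wpM2l.
Qed.

Lemma sum_even_terms (F : nat -> R) n : (forall i, odd i -> F i = 0) ->
  \sum_(i < (2 * n).+1) F i = \sum_(j < n.+1) F (2 * j)%N.
Proof.
move=> F0; elim: n => [|n IH]; first by rewrite !big_ord1.
rewrite mulnS 2!big_ord_recr/= IH [in RHS]big_ord_recr/= mulnS.
by rewrite F0 ?addr0// oddS oddM.
Qed.

(** The odd terms of the two binomial expansions cancel. *)
Lemma symmetrised_even_power (t u : R) n :
  (t + u) ^+ (2 * n) + (t - u) ^+ (2 * n)
  = 2 * \sum_(j < n.+1)
        ('C(2 * n, 2 * j)%:R * (t ^+ 2) ^+ (n - j) * (u ^+ 2) ^+ j).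
Proof.
rewrite exprDn exprBn -big_split/=.
rewrite (sum_even_terms (F := fun i =>
  t ^+ (2 * n - i) * u ^+ i *+ 'C(2 * n, i) +
  ((-1) ^+ i * t ^+ (2 * n - i) * u ^+ i) *+ 'C(2 * n, i))); last first.
  by move=> i oi; rewrite -signr_odd oi mulN1r mulNr mulNrn subrr.
rewrite mulr_sumr; apply: eq_bigr => j _.
rewrite -signr_odd oddM/= expr0 mul1r -mulnBr -!exprM -mulr_natr.
ring.
Qed.

(** This compares the j-th coefficient of E (t + u xi)^(2n) with that of
    (t^2 + (2n-1) u^2)^n. The ratio of two consecutive coefficients is
    (n-j)(2n-2j-1)/(j+1) on the left and (n-j)(2n-1)/(j+1) on the right. *)
Lemma bin_double_fact n j :
  ('C(2 * n, 2 * j) * \prod_(i < j) (2 * i).+1 <= 'C(n, j) * (2 * n).-1 ^ j)%N.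
Proof.
elim: j => [|j IH]; first by rewrite big_ord0 !muln0 !bin0.
have e1 : ('C(2 * n, 2 * j.+1) * ((2 * j).+1 * (2 * j).+2) =
          'C(2 * n, 2 * j) * ((2 * n - 2 * j) * (2 * n - 2 * j).-1))%N.
  rewrite mulnS -[(2 + _)%N]/((2 * j).+2).
  have h1 := mul_bin_left (2 * n) (2 * j).
  have h2 := mul_bin_left (2 * n) (2 * j).+1.
  have h3 : (2 * n - (2 * j).+1 = (2 * n - 2 * j).-1)%N by rewrite subnS.
  rewrite h3 in h2.
  rewrite mulnC -mulnA h2 mulnCA h1 mulnA [X in (X * _)%N = _]mulnC.
  by rewrite mulnC.
have e2 := mul_bin_left n j.
rewrite -(leq_pmul2l (ltn0Sn (2 * j).+1)) big_ord_recr/=.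
have -> : ((2 * j).+2 * ('C(2 * n, 2 * j.+1) *
    (\prod_(i < j) (2 * i).+1 * (2 * j).+1)) =
    'C(2 * n, 2 * j) * \prod_(i < j) (2 * i).+1 *
    ((2 * n - 2 * j) * (2 * n - 2 * j).-1))%N.
  by rewrite mulnAC -e1; ring.
have -> : ((2 * j).+2 * ('C(n, j.+1) * (2 * n).-1 ^ j.+1) =
    'C(n, j) * (2 * n).-1 ^ j * ((2 * n - 2 * j) * (2 * n).-1))%N.
  have -> : (2 * j).+2 = (2 * j.+1)%N by rewrite mulnS.
  rewrite expnS -mulnBr.
  have -> : ('C(n, j) * (2 * n).-1 ^ j * (2 * (n - j) * (2 * n).-1) =
    (n - j) * 'C(n, j) * (2 * ((2 * n).-1 * (2 * n).-1 ^ j)))%N by ring.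
  by rewrite -e2; ring.
apply: leq_mul => //; apply: leq_mul => //.
by rewrite -!subn1 leq_sub2r// leq_subr.
Qed.

End symmetrised_powers.

(** * Powers of a quadratic polynomial of a Gaussian variable *)

Section gaussian_quadratic.
Context {R : realType}.
Implicit Types a b c s x : R.

(** Complete the square after multiplication by c. *)
Lemma quadratic_ge0 a b c x : 0 <= a -> 0 <= c -> b ^+ 2 <= a * c ->
  0 <= a + 2 * b * x + c * x ^+ 2.
Proof.
move=> a0 c0 bac.
have [c00|cn0] := eqVneq c 0.
  have : b ^+ 2 <= 0 by rewrite c00 mulr0 in bac.
  by rewrite le_eqVlt ltNge sqr_ge0 orbF sqrf_eq0 => /eqP->; rewrite c00; lra.
have cp : 0 < c by rewrite lt_neqAle eq_sym cn0.
rewrite -(pmulr_rge0 _ cp).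
have -> : c * (a + 2 * b * x + c * x ^+ 2)
  = (c * x + b) ^+ 2 + (a * c - b ^+ 2) by ring.
by rewrite addr_ge0 ?sqr_ge0// subr_ge0.
Qed.

(** Averaging over the sign of x makes the left side increasing in b^2, so the
    worst case is b^2 = a c, where the quadratic is a perfect square
    (sqrt a + sqrt c x)^2. *)
Lemma symmetrised_quadratic_le a b c x n : 0 <= a -> 0 <= c ->
  b ^+ 2 <= a * c ->
  (a + 2 * b * x + c * x ^+ 2) ^+ n + (a + 2 * b * (- x) + c * (- x) ^+ 2) ^+ n
  <= 2 * \sum_(j < n.+1)
         ('C(2 * n, 2 * j)%:R * a ^+ (n - j) * c ^+ j * x ^+ (2 * j)).
Proof.
move=> a0 c0 bac.
pose t := Num.sqrt a; pose u := Num.sqrt c * x.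
have t2 : t ^+ 2 = a by rewrite sqr_sqrtr.
have u2 : u ^+ 2 = c * x ^+ 2 by rewrite exprMn sqr_sqrtr.
have -> : a + 2 * b * x + c * x ^+ 2 = (t ^+ 2 + u ^+ 2) + 2 * b * x.
  by rewrite t2 u2; ring.
have -> : a + 2 * b * (- x) + c * (- x) ^+ 2 = (t ^+ 2 + u ^+ 2) - 2 * b * x.
  by rewrite t2 u2; ring.
apply: (@le_trans _ _ ((t ^+ 2 + u ^+ 2 + 2 * t * u) ^+ n +
                       (t ^+ 2 + u ^+ 2 - 2 * t * u) ^+ n)).
  apply: symmetrised_power_le; first by rewrite addr_ge0// sqr_ge0.
  rewrite !exprMn t2 sqr_sqrtr//.
  have -> : 2 ^+ 2 * a * (c * x ^+ 2) = 2 ^+ 2 * (a * c) * x ^+ 2 by ring.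
  by rewrite ler_wpM2r ?sqr_ge0// ler_wpM2l.
have -> : t ^+ 2 + u ^+ 2 + 2 * t * u = (t + u) ^+ 2 by ring.
have -> : t ^+ 2 + u ^+ 2 - 2 * t * u = (t - u) ^+ 2 by ring.
rewrite -!exprM symmetrised_even_power t2 u2.
rewrite ler_wpM2l//; apply: ler_sum => j _.
by rewrite exprMn -exprM !mulrA.
Qed.

(** For a perfect square this says that the L^(2n) norm of a Gaussian
    perturbation t + u xi is at most (t^2 + (2n-1) s^2 u^2)^(1/2), the sharp
    hypercontractive bound; the exact constant 2n-1 is what lets the smallness
    of the diffusion be absorbed by the dissipation. The general case reduces
    to it by symmetrising, and the coefficients of the two polynomials are
    compared one by one. *)
Lemma gaussian_quadratic_moment s a b c n : s != 0 ->
  0 <= a -> 0 <= c -> b ^+ 2 <= a * c ->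
  (\int[normal_prob 0 s]_x ((a + 2 * b * x + c * x ^+ 2) ^+ n)%:E
   <= ((a + (2 * n).-1%:R * s ^+ 2 * c) ^+ n)%:E)%E.
Proof.
move=> s0 a0 c0 bac.
pose q x := (a + 2 * b * x + c * x ^+ 2) ^+ n.
have mq : measurable_fun [set: R] q.
  apply: measurable_funX; apply: measurable_funD.
    by apply: measurable_funD => //; apply: measurable_funM.
  by apply: measurable_funM => //; exact: exprn_measurable.
have q0 x : 0 <= q x by rewrite exprn_ge0// quadratic_ge0.
have sym : (\int[normal_prob 0 s]_x (q x)%:E =
            \int[normal_prob 0 s]_x (q (- x)%R)%:E)%E.
  have mqN : measurable_fun [set: R] (fun x => (q (- x)%R)%:E).
    apply/measurable_EFinP; apply: (measurableT_comp mq).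
    exact: measurable_funN.
  rewrite (ge0_integral_normal_prob s mqN); last by move=> x; rewrite lee_fin.
  rewrite ge0_integral_normal_prob; last 2 first.
  - exact/measurable_EFinP.
  - by move=> x; rewrite lee_fin.
  rewrite -ge0_integral_lebesgue_opp; last 2 first.
  - apply: emeasurable_funM; first exact/measurable_EFinP.
    by apply/measurable_EFinP; exact: measurable_normal_pdf.
  - by move=> x; rewrite mule_ge0// lee_fin// normal_pdf_ge0.
  apply: eq_integral => x _; congr (_ * (_)%:E)%E.
  by rewrite !normal_pdfE// /normal_fun !subr0 sqrrN.
have mqN : measurable_fun [set: R] (fun x => q (- x)).
  by apply: (measurableT_comp mq); exact: measurable_funN.
rewrite -(@lee_pmul2l _ 2%:E)//.
have -> : (2%:E * \int[normal_prob 0 s]_x (q x)%:E =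
    \int[normal_prob 0 s]_x (q x + q (- x)%R)%:E)%E.
  rewrite (_ : (2%:E : \bar R) = (1 + 1)%E)// ge0_muleDl// !mul1e {2}sym.
  rewrite -ge0_integralD//.
  - by move=> x _; rewrite lee_fin.
  - exact/measurable_EFinP.
  - by move=> x _; rewrite lee_fin.
  - exact/measurable_EFinP.
pose k (j : nat) := 'C(2 * n, 2 * j)%:R * a ^+ (n - j) * c ^+ j.
have k0 j : 0 <= 2 * k j by rewrite !mulr_ge0 ?exprn_ge0.
have me j : measurable_fun [set: R] (fun x : R => x ^+ (2 * j)).
  exact: exprn_measurable.
have e0 j x : 0 <= x ^+ (2 * j) by rewrite exprM exprn_ge0 ?sqr_ge0.
apply: (@le_trans _ _ (\int[normal_prob 0 s]_x
    \sum_(j < n.+1) (2 * k j)%:E * (x ^+ (2 * j))%:E)%E).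
  apply: ge0_le_integral => //.
  - by move=> x _; rewrite lee_fin addr_ge0.
  - by apply/measurable_EFinP; exact: measurable_funD.
  - apply: emeasurable_sum => j; apply: emeasurable_funM => //.
    exact/measurable_EFinP.
  - move=> x _; under eq_bigr do rewrite -EFinM.
    rewrite sumEFin lee_fin; under eq_bigr do rewrite -mulrA.
    by rewrite -mulr_sumr; exact: symmetrised_quadratic_le.
rewrite ge0_integral_sum//; last 2 first.
- by move=> j; apply: emeasurable_funM => //; exact/measurable_EFinP.
- by move=> j x _; rewrite -EFinM lee_fin mulr_ge0.
apply: (@le_trans _ _ (\sum_(j < n.+1)
    (2 * k j * (\prod_(i < j) (2 * i).+1%:R * s ^+ (2 * j)))%:E)%E).
  apply: lee_sum => j _.
  rewrite ge0_integralZl//; last 3 first.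
  - exact/measurable_EFinP.
  - by move=> x _; rewrite lee_fin.
  - by rewrite lee_fin.
  by rewrite [leRHS]EFinM lee_wpmul2l ?lee_fin//; exact: even_moment_le.
rewrite sumEFin -EFinM lee_fin exprDn mulr_sumr; apply: ler_sum => j _.
have H := bin_double_fact n j; rewrite -(ler_nat R) !natrM natrX natr_prod in H.
have es : s ^+ (2 * j) = s ^+ j * s ^+ j by rewrite mul2n -addnn exprD.
have Y0 : 0 <= 2 * (a ^+ (n - j) * (c ^+ j * (s ^+ j * s ^+ j))).
  by rewrite -es mulr_ge0// !mulr_ge0 ?e0// exprn_ge0.
rewrite -[X in _ <= 2 * X]mulr_natr !exprMn.
apply: le_trans (le_trans (ler_wpM2r Y0 H) _).
  by rewrite /k es le_eqVlt; apply/orP; left; apply/eqP; ring.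
by rewrite le_eqVlt; apply/orP; left; apply/eqP; ring.
Qed.

End gaussian_quadratic.

(** * Noise independent of a sub-sigma-algebra *)

Definition mfun_of d d' (T : measurableType d) (T' : measurableType d')
    (f : T -> T') (mf : measurable_fun setT f) : {mfun T >-> T'} :=
  HB.pack f (isMeasurableFun.Build _ _ _ _ f mf).

Section independent_of_generated.
Context {R : realType} {disp : measure_display} {T : measurableType disp}.
Variables (P : probability T R) (G : set (set T)).
Hypothesis GM : G `<=` measurable.

Lemma sigma_generated_measurable : <<s G >> `<=` @measurable _ T.
Proof. exact: (smallest_sub (@sigma_algebra_measurable _ T) GM). Qed.

(** Both sides are finite measures in A, so agreement on a pi-system suffices. *)
Lemma independent_generated (E : set T) :
  G setT -> setI_closed G -> measurable E ->
  (forall A, G A -> (P (A `&` E) = P A * P E)%E) ->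
  forall A, <<s G >> A -> (P (A `&` E) = P A * P E)%E.
Proof.
move=> GT GI mE GE A sA.
pose q : {nonneg R} := NngNum (fine_ge0 (measure_ge0 P E)).
have qE : (q%:num%:E = P E)%E by rewrite /= fineK// fin_num_measure.
suff : mrestr P mE A = mscale q P A by rewrite /mrestr /mscale qE muleC.
apply: (g_sigma_algebra_measure_unique G GM (fun=> setT)) => //.
- by rewrite bigcup_const//; exists 0%N.
- by move=> B GB; rewrite -[LHS]/(P (B `&` E)) GE// -qE muleC.
- move=> _; apply: le_lt_trans (ltry 1); rewrite -[leLHS]/(P (setT `&` E)).
  by rewrite setTI probability_le1.
Qed.

(** The joint law of the identity, read with values in T equipped with the
    generated sigma-algebra, and of xi is a product measure. This plays the
    role of conditioning: the integrand may depend on w in any way measurable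
    for the sub-sigma-algebra. *)
Lemma fubini_independent (xi : T -> R) (s : R)
    (f : g_sigma_algebraType G * measurableTypeR R -> \bar R) :
  measurable_fun setT xi ->
  (forall A B, <<s G >> A -> measurable B ->
     (P (A `&` xi @^-1` B) = P A * normal_prob 0 s B)%E) ->
  measurable_fun setT f -> (forall z, 0 <= f z)%E ->
  (\int[P]_w f (w, xi w) = \int[P]_w \int[normal_prob 0 s]_x f (w, x))%E.
Proof.
move=> mxi ind mf f0.
pose i : T -> g_sigma_algebraType G := idfun.
have mi : measurable_fun [set: T] i.
  by move=> _ A mA; rewrite setTI; exact: sigma_generated_measurable.
pose Q := distribution P (mfun_of mi).
pose j : T -> g_sigma_algebraType G * measurableTypeR R := fun w => (i w, xi w).
have mj : measurable_fun [set: T] j by exact: measurable_fun_pair.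
have QN X : measurable X ->
    (Q \x normal_prob 0 s)%E X = distribution P (mfun_of mj) X.
  by apply: product_measure_unique => A B mA mB; rewrite -ind.
transitivity (\int[distribution P (mfun_of mj)]_z f z)%E.
  by rewrite ge0_integral_distribution.
transitivity (\int[Q \x normal_prob 0 s]_z f z)%E.
  apply: eq_measure_integral => X mX _; first [exact: QN | exact/esym/QN].
rewrite fubini_tonelli1// ge0_integral_distribution//.
- exact: measurable_fun_fubini_tonelli_F.
- by move=> x; exact: integral_ge0.
Qed.

(** [gaussian_quadratic_moment] with random coefficients that are known before
    the noise xi. *)
Lemma expectation_gaussian_quadratic (xi a b c : T -> R) (s : R) n :
  s != 0 -> measurable_fun setT xi ->
  (forall A B, <<s G >> A -> measurable B ->
     (P (A `&` xi @^-1` B) = P A * normal_prob 0 s B)%E) ->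
  measurable_fun [set: g_sigma_algebraType G] a ->
  measurable_fun [set: g_sigma_algebraType G] b ->
  measurable_fun [set: g_sigma_algebraType G] c ->
  (forall w, 0 <= a w) -> (forall w, 0 <= c w) ->
  (forall w, b w ^+ 2 <= a w * c w) ->
  (\int[P]_w ((a w + 2 * b w * xi w + c w * xi w ^+ 2) ^+ n)%:E
   <= \int[P]_w ((a w + (2 * n).-1%:R * s ^+ 2 * c w) ^+ n)%:E)%E.
Proof.
move=> s0 mxi ind ma mb mc a0 c0 bac.
pose f (z : g_sigma_algebraType G * measurableTypeR R) : \bar R :=
  ((a z.1 + 2 * b z.1 * z.2 + c z.1 * z.2 ^+ 2) ^+ n)%:E.
have mfst g : measurable_fun [set: g_sigma_algebraType G] g ->
    measurable_fun [set: g_sigma_algebraType G * measurableTypeR R]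
      (fun z => g z.1 : R).
  by move=> mg; apply: (measurableT_comp mg); exact: measurable_fst.
have msnd : measurable_fun [set: g_sigma_algebraType G * measurableTypeR R]
      (fun z => z.2 : R) by exact: measurable_snd.
have mf : measurable_fun setT f.
  apply/measurable_EFinP; apply: measurable_funX; apply: measurable_funD.
    apply: measurable_funD; first exact: mfst.
    by apply: measurable_funM => //; apply: measurable_funM => //; exact: mfst.
  by apply: measurable_funM; [exact: mfst|exact: measurable_funX].
have f0 z : (0 <= f z)%E.
  by rewrite lee_fin exprn_ge0// quadratic_ge0.
rewrite (fubini_independent mxi ind mf f0).
have mT g : measurable_fun [set: g_sigma_algebraType G] g ->
    measurable_fun [set: T] (g : T -> R).
  move=> mg _ A mA; rewrite setTI; apply: sigma_generated_measurable.
  by have := mg measurableT _ mA; rewrite setTI.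
apply: ge0_le_integral => //.
- by move=> w _; exact: integral_ge0.
- have := @measurable_fun_fubini_tonelli_F _ _ (g_sigma_algebraType G)
    (measurableTypeR R) R (normal_prob 0 s) f mf f0.
  move=> mF _ A mA; rewrite setTI; apply: sigma_generated_measurable.
  by have := mF measurableT _ mA; rewrite setTI.
- apply/measurable_EFinP; apply: measurable_funX; apply: measurable_funD.
    exact: mT.
  by apply: measurable_funM => //; exact: mT.
- move=> w _; have := gaussian_quadratic_moment n s0 (a0 w) (c0 w) (bac w).
  by rewrite /f/=.
Qed.

End independent_of_generated.

Section measurable_sub_sigma_algebra.
Context {R : realType} {T : pointedType}.

Lemma measurable_fun_g_sigma_sub (G G' : set (set T)) d (U : measurableType d)
    (f : T -> U) : G `<=` <<s G' >> ->
  measurable_fun [set: g_sigma_algebraType G] f ->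
  measurable_fun [set: g_sigma_algebraType G'] f.
Proof.
move=> GG' mf _ A mA; have := mf measurableT _ mA; rewrite !setTI.
apply: smallest_sub; [exact: smallest_sigma_algebra|exact: GG'].
Qed.

Lemma measurable_inner d (G : set (set T)) (u v : T -> 'cV[R]_d) :
  (forall c, measurable_fun [set: g_sigma_algebraType G] (fun w => u w c ord0)) ->
  (forall c, measurable_fun [set: g_sigma_algebraType G] (fun w => v w c ord0)) ->
  measurable_fun [set: g_sigma_algebraType G] (fun w => inner (u w) (v w)).
Proof.
by move=> mu mv; apply: measurable_sum => c; exact: measurable_funM.
Qed.

End measurable_sub_sigma_algebra.

(** * Gaussian vectors independent of the past *)

Section gaussian_vector.
Context {R : realType} {disp : measure_display} {T : measurableType disp}.
Variables (P : probability T R) (G : set (set T)) (m : nat).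
Variables (xi : 'I_m -> T -> R) (s : R).
Hypothesis GM : G `<=` measurable.
Hypothesis mxi : forall l, measurable_fun setT (xi l).
Hypothesis s0 : s != 0.
Hypothesis xi_gauss : forall (A : set T) (B : 'I_m -> set R), <<s G >> A ->
  (forall l, measurable (B l)) ->
  (P (A `&` [set w | forall l, B l (xi l w)])
   = P A * \prod_l normal_prob 0 s (B l))%E.

(** The information in G together with the first k coordinates of the noise,
    presented as a pi-system. *)
Definition past_upto (k : nat) : set (set T) :=
  [set A | exists A0 (B : 'I_m -> set R),
     [/\ <<s G >> A0, forall l, measurable (B l),
         forall l : 'I_m, (k <= l)%N -> B l = setT &
         A = A0 `&` [set w | forall l, B l (xi l w)]]].

Let sGT : <<s G >> setT.
Proof. exact: (@measurableT _ (g_sigma_algebraType G)). Qed.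

Let measurable_box (B : 'I_m -> set R) : (forall l, measurable (B l)) ->
  measurable [set w | forall l, B l (xi l w)].
Proof.
move=> mB; have -> : [set w | forall l, B l (xi l w)] =
    \bigcap_(l in [set: 'I_m]) (xi l @^-1` B l).
  by apply/seteqP; split => [w Bw l _|w Bw l]; exact: Bw.
apply: fin_bigcap_measurable => // l _.
by rewrite -[_ @^-1` _]setTI; exact: mxi.
Qed.

Lemma past_upto_measurable k : past_upto k `<=` measurable.
Proof.
move=> _ [A [B [sA mB _ ->]]]; apply: measurableI; last exact: measurable_box.
exact: sigma_generated_measurable sA.
Qed.

Lemma past_uptoT k : past_upto k setT.
Proof.
exists setT, (fun=> setT); split => //.
by apply/seteqP; split.
Qed.

Lemma past_upto_setI k : setI_closed (past_upto k).
Proof.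
move=> _ _ [A [B [sA mB BT ->]]] [A' [B' [sA' mB' BT' ->]]].
exists (A `&` A'), (fun l => B l `&` B' l); split.
- exact: (@measurableI _ (g_sigma_algebraType G)).
- by move=> l; exact: measurableI.
- by move=> l kl; rewrite BT// BT'// setTI.
apply/seteqP; split => w /=.
  by move=> [[? Bw] [? Bw']]; split.
by move=> [[? ?] BB]; do 2 split => //; move=> l; have [] := BB l.
Qed.

Lemma sub_past_upto k : G `<=` <<s past_upto k >>.
Proof.
move=> A GA; apply: sub_sigma_algebra; exists A, (fun=> setT); split => //.
  exact: sub_sigma_algebra.
by apply/seteqP; split => [w|w []].
Qed.

Lemma measurable_past_upto k (l : 'I_m) : (l < k)%N ->
  measurable_fun [set: g_sigma_algebraType (past_upto k)] (xi l).
Proof.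
move=> lk _ A mA; rewrite setTI; apply: sub_sigma_algebra.
exists setT, (fun i => if i == l then A else setT); split => //.
- by move=> i; case: ifP.
- by move=> i; case: eqP => // ->; rewrite leqNgt lk.
apply/seteqP; split => [w /= Aw|w /= [_ /(_ l)]]; last by rewrite eqxx.
by split => // i; case: eqP => // ->.
Qed.

Lemma past_upto_independent (l : 'I_m) (A : set T) (B : set R) :
  <<s past_upto l >> A -> measurable B ->
  (P (A `&` xi l @^-1` B) = P A * normal_prob 0 s B)%E.
Proof.
move=> sA mB.
have key A0 (B0 : 'I_m -> set R) : <<s G >> A0 -> (forall i, measurable (B0 i)) ->
    B0 l = setT ->
    (P (A0 `&` [set w | forall i, B0 i (xi i w)] `&` xi l @^-1` B)
     = P (A0 `&` [set w | forall i, B0 i (xi i w)]) * normal_prob 0 s B)%E.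
  move=> sA0 mB0 B0T; pose B1 i := if i == l then B else B0 i.
  have -> : A0 `&` [set w | forall i, B0 i (xi i w)] `&` xi l @^-1` B
      = A0 `&` [set w | forall i, B1 i (xi i w)].
    apply/seteqP; split => w /=.
      by move=> [[? B0w] Bw]; split => // i; rewrite /B1; case: eqP => // ->.
    move=> [? B1w]; split; last by have := B1w l; rewrite /B1 eqxx.
    split => // i; have := B1w i; rewrite /B1; case: eqP => // ->.
    by rewrite B0T.
  have mB1 i : measurable (B1 i) by rewrite /B1; case: ifP.
  rewrite !xi_gauss// -muleA; congr (_ * _)%E.
  rewrite (bigD1 l)//= [in RHS](bigD1 l)//= /B1 eqxx B0T probability_setT mul1e.
  rewrite muleC; congr (_ * _)%E; apply: eq_bigr => i /negbTE il.
  by rewrite il.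
have PB : (P (xi l @^-1` B) = normal_prob 0 s B)%E.
  have := key setT (fun=> setT) sGT (fun=> measurableT) erefl.
  have -> : [set w | forall i : 'I_m, [set: R] (xi i w)] = setT.
    by apply/seteqP; split.
  by rewrite !setTI probability_setT mul1e.
rewrite -PB; apply: (independent_generated (past_upto_measurable (k := l))) => //.
- exact: past_uptoT.
- exact: past_upto_setI.
- by rewrite -[_ @^-1` _]setTI; exact: mxi.
- by move=> _ [A0 [B0 [sA0 mB0 BT ->]]]; rewrite PB key// BT.
Qed.

End gaussian_vector.

Section gaussian_vector_moment.
Context {R : realType} {disp : measure_display} {T : measurableType disp}.
Variables (P : probability T R) (G : set (set T)) (d m : nat).
Variables (xi : 'I_m -> T -> R) (s : R).
Hypothesis GM : G `<=` measurable.
Hypothesis mxi : forall l, measurable_fun setT (xi l).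
Hypothesis s0 : s != 0.
Hypothesis xi_gauss : forall (A : set T) (B : 'I_m -> set R), <<s G >> A ->
  (forall l, measurable (B l)) ->
  (P (A `&` [set w | forall l, B l (xi l w)])
   = P A * \prod_l normal_prob 0 s (B l))%E.

(** The coordinates of the noise are integrated out from the last to the first.
    Removing the coordinate l replaces xi_l B_l by the deterministic surplus
    (2n-1) s^2 |B_l|^2, where B_l is the l-th column of B; the surplus of the
    coordinates already removed is part of the summand r of the next step, and
    the squares of the columns add up to the Hilbert-Schmidt norm. *)
Lemma expectation_gaussian_vector (x : T -> 'cV[R]_d) (B : T -> 'M[R]_(d, m))
    (r : T -> R) n :
  (forall c, measurable_fun [set: g_sigma_algebraType G] (fun w => x w c ord0)) ->
  (forall c l, measurable_fun [set: g_sigma_algebraType G] (fun w => B w c l)) ->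
  measurable_fun [set: g_sigma_algebraType G] r -> (forall w, 0 <= r w) ->
  (\int[P]_w ((enorm (x w + B w *m \col_l xi l w) ^+ 2 + r w) ^+ n)%:E
   <= \int[P]_w ((enorm (x w) ^+ 2
        + ((2 * n).-1%:R * s ^+ 2 * hsnorm (B w) ^+ 2 + r w)) ^+ n)%:E)%E.
Proof.
move=> mx mB mr r0.
pose K := (2 * n).-1%:R * s ^+ 2.
have K0 : 0 <= K by rewrite mulr_ge0// sqr_ge0.
pose u (k : nat) w : 'cV[R]_d := x w + \sum_(l < m | (l < k)%N) xi l w *: col l (B w).
pose q (k : nat) w := K * \sum_(l < m | (k <= l)%N) inner (col l (B w)) (col l (B w)).
have q0 k w : 0 <= q k w.
  by rewrite mulr_ge0//; apply: sumr_ge0 => l _; exact: inner_ge0.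
have mcol l c : measurable_fun [set: g_sigma_algebraType G]
    (fun w => col l (B w) c ord0).
  by under eq_fun do rewrite mxE; exact: mB.
have lift k (f : T -> R) : measurable_fun [set: g_sigma_algebraType G] f ->
    measurable_fun [set: g_sigma_algebraType (past_upto G xi k)] f.
  apply: measurable_fun_g_sigma_sub; exact: sub_past_upto.
have mq k : measurable_fun [set: g_sigma_algebraType G] (q k).
  apply: measurable_funM => //.
  under eq_fun do rewrite big_mkcond.
  apply: measurable_sum => l; case: (k <= l)%N => //.
  by apply: measurable_inner => c; exact: mcol.
have mu k c : measurable_fun [set: g_sigma_algebraType (past_upto G xi k)]
    (fun w => u k w c ord0).
  rewrite /u; under eq_fun do rewrite mxE summxE big_mkcond.
  apply: measurable_funD; first exact: lift.
  apply: measurable_sum => l; case: (ltnP l k) => lk //.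
  under eq_fun do rewrite mxE.
  by apply: measurable_funM; [exact: measurable_past_upto|apply: lift; exact: mcol].
pose Phi k := (\int[P]_w ((enorm (u k w) ^+ 2 + (q k w + r w)) ^+ n)%:E)%E.
have step k : (k < m)%N -> (Phi k.+1 <= Phi k)%E.
  move=> km; pose l := Ordinal km.
  pose a w := enorm (u k w) ^+ 2 + (q k.+1 w + r w).
  pose b w := inner (u k w) (col l (B w)).
  pose c w := inner (col l (B w)) (col l (B w)).
  have qE w : q k w = K * c w + q k.+1 w.
    rewrite /q (bigD1 l)//= mulrDr; congr (_ + K * _).
    apply: eq_bigl => i; rewrite [RHS]ltn_neqAle [RHS]andbC.
    by rewrite [k == i :> nat]eq_sym.
  have uE w : u k.+1 w = u k w + xi l w *: col l (B w).
    rewrite /u (bigD1 l)//= -addrA; congr (_ + _); rewrite addrC; congr (_ + _).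
    apply: eq_bigl => i; rewrite ltnS andbC ltn_neqAle.
    by [].
  have := @expectation_gaussian_quadratic R _ T P (past_upto G xi k)
    (past_upto_measurable GM mxi (k := k)) (xi l) a b c s n s0 (mxi l).
  rewrite -/K => H.
  have lhsE w : enorm (u k.+1 w) ^+ 2 + (q k.+1 w + r w) =
      a w + 2 * b w * xi l w + c w * xi l w ^+ 2.
    by rewrite uE sqr_enormD sqr_enorm (sqr_enorm (col l _)) /a /b /c sqr_enorm; ring.
  have rhsE w : enorm (u k w) ^+ 2 + (q k w + r w) = a w + K * c w.
    by rewrite qE /a; ring.
  rewrite /Phi; under eq_integral do rewrite lhsE.
  under [leRHS]eq_integral do rewrite rhsE.
  apply: H.
  - by move=> A E sA mE; exact: (past_upto_independent GM mxi xi_gauss (l := l)).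
  - rewrite /a; under eq_fun do rewrite sqr_enorm.
    apply: measurable_funD; first by apply: measurable_inner.
    by apply: lift; apply: measurable_funD.
  - by apply: measurable_inner => // c'; exact: lift.
  - by apply: measurable_inner => // c'; exact: lift.
  - by move=> w; rewrite !addr_ge0// sqr_ge0.
  - by move=> w; exact: inner_ge0.
  - move=> w; apply: (le_trans (cauchy_schwarz _ _)).
    by rewrite ler_wpM2r ?inner_ge0// /a sqr_enorm lerDl addr_ge0.
have mono k : (k <= m)%N -> (Phi k <= Phi 0%N)%E.
  elim: k => // k IH km; apply: le_trans (IH (ltnW km)); exact: step.
suff [-> ->] : (\int[P]_w ((enorm (x w + B w *m \col_l xi l w) ^+ 2 + r w) ^+ n)%:E)%E
    = Phi m /\ (\int[P]_w ((enorm (x w) ^+ 2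
        + (K * hsnorm (B w) ^+ 2 + r w)) ^+ n)%:E)%E = Phi 0%N.
  exact: mono.
split; apply: eq_integral => w _; congr (_ ^+ _)%:E.
  have -> : q m w = 0.
    by rewrite /q big1 ?mulr0// => l; rewrite leqNgt ltn_ord.
  rewrite add0r; congr (enorm _ ^+ 2 + _); rewrite /u; congr (_ + _).
  apply/colP => c; rewrite mxE summxE [RHS](eq_bigl xpredT); last first.
    by move=> l; rewrite ltn_ord.
  by apply: eq_bigr => l _; rewrite !mxE mulrC.
have -> : u 0%N w = x w by rewrite /u big_pred0 ?addr0.
rewrite /q sqr_hsnorm; congr (_ + (_ * _ + _)); apply: eq_big => // l _.
by apply: eq_bigr => c _; rewrite !mxE expr2.
Qed.

End gaussian_vector_moment.

(** * The past of the copies of the Brownian motion *)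

Lemma ae_measure_eq {R : realType} d (T : measurableType d)
    (P : {measure set T -> \bar R}) (A B : set T) :
  measurable A -> measurable B -> {ae P, forall w, A w <-> B w} -> P A = P B.
Proof.
have half (A' B' : set T) : measurable A' -> measurable B' ->
    {ae P, forall w, A' w <-> B' w} -> (P A' <= P B')%E.
  move=> mA mB [N [mN PN sN]].
  rewrite -[leRHS]adde0 -PN; apply: (le_trans _ (measureU2 P mB mN)).
  apply: le_measure; rewrite ?inE//; first exact: measurableU.
  move=> w Aw; have [Nw|Nw] := pselect (N w); [by right|left].
  by have [] := subsetCl sN Nw => /(_ Aw).
move=> mA mB AB; apply/eqP; rewrite eq_le !half//.
by apply: filterS AB => w; tauto.
Qed.

Section past_of_copies.
Context {R : realType} {d m : nat} {disp : measure_display}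
  {T : measurableType disp} {P : probability T R}.
Variables (F : R -> set (set T)) (W : T -> pathV R m) (X0 : T -> borelV R d).
Variables (N : nat) (Wc : 'I_N.+1 -> T -> pathV R m)
  (X0c : 'I_N.+1 -> T -> borelV R d).
Hypothesis hF : complete_filtration P F.
Hypothesis hW : brownian_motion P F W.
Hypothesis hX0 : F_measurable (F 0) X0.
Hypothesis hcopies : iid_copies P (fun w => (W w, X0 w))
  (fun j w => (Wc j w, X0c j w)).

Let Z w : (pathV R m * borelV R d)%type := (W w, X0 w).
Let Zc j w : (pathV R m * borelV R d)%type := (Wc j w, X0c j w).

(** Path-space events that the original pair (W, X0) decides by time t. They
    carry the filtration over to the copies, for which only the law is given. *)
Definition adapted_event (t : R) : set (set (pathV R m * borelV R d)) :=
  [set E | measurable E /\ F t (Z @^-1` E)].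

(** Events decided by time t by all the copies, up to null sets. Taking
    intersections of one event per particle makes this a pi-system on which
    the product law can be evaluated; allowing almost everywhere equality puts
    every null set in it, so that processes that solve an equation only almost
    surely can still be measurable for it. *)
Definition copies_past (t : R) : set (set T) :=
  [set A | measurable A /\ exists E : 'I_N.+1 -> set (pathV R m * borelV R d),
     (forall j, adapted_event t (E j)) /\
     {ae P, forall w, A w <-> forall j, E j (Zc j w)}].

Let mZc j : measurable_fun setT (Zc j).
Proof. by have [+ _ _] := hcopies; apply. Qed.

Let sF t : 0 <= t -> sigma_algebra setT (F t).
Proof. by move=> t0; have [_ /(_ _ t0)[]] := hF. Qed.

Let mF t A : 0 <= t -> F t A -> measurable A.
Proof. by move=> t0 FA; have [_ /(_ _ t0)[_ +] _ _] := hF; apply. Qed.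

Let FT t : 0 <= t -> F t setT.
Proof.
move=> t0; have [F0 FD _] := sF t0.
by have := FD _ F0; rewrite setD0.
Qed.

Let FI t A B : 0 <= t -> F t A -> F t B -> F t (A `&` B).
Proof.
move=> t0; rewrite -(sigma_algebra_id (sF t0)) => FA FB.
exact: (@measurableI _ (g_sigma_algebraType (F t))).
Qed.

Let mcap (E : 'I_N.+1 -> set (pathV R m * borelV R d)) :
  (forall j, measurable (E j)) ->
  measurable [set w | forall j, E j (Zc j w)].
Proof.
move=> mE; have -> : [set w | forall j, E j (Zc j w)] =
    \bigcap_(j in [set: 'I_N.+1]) (Zc j @^-1` E j).
  by apply/seteqP; split => [w Bw l _|w Bw l]; exact: Bw.
apply: fin_bigcap_measurable => // j _.
by rewrite -[_ @^-1` _]setTI; exact: mZc.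
Qed.

Lemma copies_past_measurable t : copies_past t `<=` measurable.
Proof. by move=> A []. Qed.

Lemma copies_pastT t : 0 <= t -> copies_past t setT.
Proof.
move=> t0; split => //; exists (fun=> setT); split; last exact: aeW.
by move=> j; split => //; rewrite preimage_setT; exact: FT.
Qed.

Lemma copies_past_setI t : 0 <= t -> setI_closed (copies_past t).
Proof.
move=> t0 A B [mA [E [FE AE]]] [mB [D [FD BD]]].
split; first exact: measurableI.
exists (fun j => E j `&` D j); split.
  move=> j; have [? ?] := FE j; have [? ?] := FD j.
  by split; [exact: measurableI|rewrite preimage_setI; exact: FI].
apply: filterS2 AE BD => w AE BD; split.
  by move=> [/AE Ew /BD Dw] j; split.
by move=> ED; split; [apply/AE|apply/BD] => j; have [] := ED j.
Qed.

Lemma copies_past_homo s t : 0 <= s -> s <= t -> copies_past s `<=` copies_past t.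
Proof.
move=> s0 st A [mA [E [FE AE]]]; split => //; exists E; split => // j.
have [? ?] := FE j; split => //.
by have [_ _ /(_ _ _ s0 st) + _] := hF; apply.
Qed.

Lemma negligible_copies_past t A : 0 <= t -> P.-negligible A -> copies_past t A.
Proof.
move=> t0 nA; split; first by have [+ _ _ _] := hF; apply.
exists (fun=> set0); split.
  by move=> j; split => //; rewrite preimage_set0; have [] := sF t0.
case: nA => B [mB PB AB]; exists B; split => // w /= nAw; apply: AB.
by apply: contrapT => Aw; apply: nAw; split => // /(_ ord0).
Qed.

Lemma adapted_copies_past t j (E : set (pathV R m * borelV R d)) :
  0 <= t -> adapted_event t E -> copies_past t (Zc j @^-1` E).
Proof.
move=> t0 [mE FE]; split; first by rewrite -[_ @^-1` _]setTI; exact: mZc.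
exists (fun i => if i == j then E else setT); split.
  move=> i; case: ifP => // _; split => //.
  by rewrite preimage_setT; exact: FT.
apply: aeW => w; split => [Ew i|/(_ j)]; last by rewrite eqxx.
by case: eqP => // ->.
Qed.

Lemma measurable_initial_copies j c :
  measurable_fun [set: g_sigma_algebraType (copies_past 0)]
    (fun w => (X0c j w : 'cV[R]_d) c ord0).
Proof.
move=> _ B mB; rewrite setTI; apply: sub_sigma_algebra.
pose C : set (borelV R d) := [set x | B ((x : 'cV[R]_d) c ord0)].
have mC : measurable C.
  by have := measurable_coord c measurableT mB; rewrite setTI.
rewrite -[X in copies_past _ X]/(Zc j @^-1` (snd @^-1` C)).
apply: adapted_copies_past => //; split; last exact: hX0.
rewrite -[_ @^-1` _]setTI; exact: measurable_snd.
Qed.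

Lemma measurable_path_eval (t : R) : 0 <= t ->
  measurable_fun [set: pathV R m] (fun p : pathV R m => p t : borelV R m).
Proof.
move=> t0 _ B mB; rewrite setTI; apply: sub_sigma_algebra.
by exists t, B; split.
Qed.

Lemma measurable_path_increment (s t : R) l : 0 <= s -> 0 <= t ->
  measurable_fun [set: pathV R m] (fun p : pathV R m => (p t - p s) l ord0).
Proof.
move=> s0 t0.
have meval (r : R) : 0 <= r ->
    measurable_fun [set: pathV R m] (fun p : pathV R m => p r l ord0).
  move=> r0; apply: (measurableT_comp (measurable_coord l)).
  exact: measurable_path_eval.
have := measurable_funB (meval _ t0) (meval _ s0).
by apply: eq_measurable_fun => p _; rewrite !mxE.
Qed.

Lemma measurable_increment_copies j (s t : R) l : 0 <= s -> s <= t ->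
  measurable_fun [set: g_sigma_algebraType (copies_past t)]
    (fun w => (increment (Wc j) s t w : 'cV[R]_m) l ord0).
Proof.
move=> s0 st; have t0 := le_trans s0 st.
move=> _ B mB; rewrite setTI; apply: sub_sigma_algebra.
pose C : set (pathV R m) :=
  (fun p : pathV R m => (p t - p s) l ord0) @^-1` B.
have mC : measurable C.
  by rewrite -[C]setTI; exact: (measurable_path_increment l s0 t0 measurableT mB).
rewrite -[X in copies_past _ X]/(Zc j @^-1` (fst @^-1` C)).
apply: adapted_copies_past => //; split.
  by rewrite -[_ @^-1` _]setTI; exact: measurable_fst.
have Wcoord (r : R) : 0 <= r -> r <= t ->
    measurable_fun [set: g_sigma_algebraType (F t)]
      (fun w => (W w r : 'cV[R]_m) l ord0).
  move=> r0 rt; apply: (measurableT_comp (measurable_coord l)).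
  move=> _ D mD; rewrite setTI; apply: sub_sigma_algebra.
  have [_ _ mono _] := hF; apply: (mono _ _ r0 rt).
  by have [_ _ + _ _] := hW; apply.
have /(_ measurableT _ mB) := measurable_funB (Wcoord _ t0 (lexx _)) (Wcoord _ s0 st).
rewrite setTI => FB; rewrite -(sigma_algebra_id (sF t0)).
rewrite (_ : _ @^-1` _ = ((fun w => (W w t : 'cV[R]_m) l ord0) \-
  (fun w => (W w s : 'cV[R]_m) l ord0)) @^-1` B); first exact: FB.
by apply/seteqP; split => w /=; rewrite /C/= !mxE.
Qed.

(** On the generating pi-system the product law of the copies splits off the
    particle i, and for this particle the claim is the independence of the
    increments of W from its filtration. *)
Lemma increment_copies_independent (s t : R) (i : 'I_N.+1) (A : set T)
    (B : 'I_m -> set R) : 0 <= s -> s < t -> <<s copies_past s >> A ->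
  (forall l, measurable (B l)) ->
  (P (A `&` [set w | forall l, B l ((increment (Wc i) s t w : 'cV[R]_m) l ord0)])
   = P A * \prod_l normal_prob 0 (Num.sqrt (t - s)) (B l))%E.
Proof.
move=> s0 st sA mB; have t0 := ltW (le_lt_trans s0 st).
pose C : set (pathV R m * borelV R d) :=
  [set z : pathV R m * borelV R d |
    forall l, B l (((z.1 t : 'cV[R]_m) - (z.1 s : 'cV[R]_m)) l ord0)].
have mC : measurable C.
  have -> : C = \bigcap_(l in [set: 'I_m])
      ((fun z => ((z.1 t : 'cV[R]_m) - (z.1 s : 'cV[R]_m)) l ord0) @^-1` B l).
    by apply/seteqP; split => [w Bw l _|w Bw l]; exact: Bw.
  apply: fin_bigcap_measurable => // l _.
  have := measurableT_comp (measurable_path_increment l s0 t0)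
    (@measurable_fst _ _ (pathV R m) (borelV R d)).
  by move=> /(_ measurableT _ (mB l)); rewrite setTI.
pose box : set (borelV R m) := [set x | forall l, B l ((x : 'cV[R]_m) l ord0)].
have mbox : measurable box.
  have -> : box = \bigcap_(l in [set: 'I_m])
      ((fun x : borelV R m => (x : 'cV[R]_m) l ord0) @^-1` B l).
    by apply/seteqP; split => [w Bw l _|w Bw l]; exact: Bw.
  apply: fin_bigcap_measurable => // l _.
  by have := measurable_coord l measurableT (mB l); rewrite setTI.
rewrite -[X in (P (A `&` X) = _)%E]/(Zc i @^-1` C).
set q := (\prod_l _)%E.
have [_ _ _ Wind Wlaw] := hW; have [_ Zlaw Zind] := hcopies.
have Pprod E : (forall j, measurable (E j)) ->
    P [set w | forall j, E j (Zc j w)] = (\prod_j P (Z @^-1` E j))%E.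
  move=> mE; have -> : [set w | forall j, E j (Zc j w)] =
      \bigcap_(j in [set: 'I_N.+1]) (Zc j @^-1` E j).
    by apply/seteqP; split => [w Bw l _|w Bw l]; exact: Bw.
  rewrite Zind//; apply: eq_bigr => j _; exact: Zlaw.
have key A' : copies_past s A' -> (P (A' `&` Zc i @^-1` C) = P A' * q)%E.
  move=> [mA' [E [FE AE]]].
  have mE j : measurable (E j) by have [] := FE j.
  have -> : P A' = P [set w | forall j, E j (Zc j w)].
    by apply: ae_measure_eq => //; exact: mcap.
  pose E' j := if j == i then E i `&` C else E j.
  have mE' j : measurable (E' j).
    by rewrite /E'; case: ifP => // _; exact: measurableI.
  have -> : P (A' `&` Zc i @^-1` C) = P [set w | forall j, E' j (Zc j w)].
    apply: ae_measure_eq; [|exact: mcap|].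
      by apply: measurableI => //; rewrite -[_ @^-1` _]setTI; exact: mZc.
    apply: filterS AE => w AE; rewrite /E'; split.
      by move=> [/AE Ew Cw] j; case: eqP => // ->.
    move=> Ew; split; last by have := Ew i; rewrite eqxx => -[].
    by apply/AE => j; have := Ew j; case: eqP => // -> [].
  rewrite !Pprod// (bigD1 i)//= [in RHS](bigD1 i)//= {1}/E' eqxx.
  have -> : (\prod_(j < N.+1 | j != i) P (Z @^-1` E' j) =
      \prod_(j < N.+1 | j != i) P (Z @^-1` E j))%E.
    by apply: eq_bigr => j /negbTE ji; rewrite /E' ji.
  rewrite preimage_setI -[Z @^-1` C]/(increment W s t @^-1` box).
  have [_ FEi] := FE i.
  rewrite (Wind _ _ s0 st _ _ FEi mbox) [X in (_ * X * _)%E](Wlaw _ _ s0 st B mB).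
  by rewrite muleAC.
have PC : P (Zc i @^-1` C) = q.
  by have := key _ (copies_pastT s0); rewrite setTI probability_setT mul1e.
rewrite -PC; apply: (independent_generated (@copies_past_measurable s)) => //.
- exact: copies_pastT.
- exact: copies_past_setI.
- by rewrite -[_ @^-1` _]setTI; exact: mZc.
- by move=> A' A'p; rewrite PC; exact: key.
Qed.

End past_of_copies.

(** * Empirical measures *)

Section empirical_wasserstein.
Context {R : realType} {d N : nat}.
Implicit Types x y : 'I_N.+1 -> 'cV[R]_d.
Local Open Scope ereal_scope.

Lemma measurable_sqr_enormB :
  measurable_fun [set: (borelV R d * borelV R d)%type]
    (fun z : borelV R d * borelV R d => (enorm (z.1 - z.2)%R ^+ 2)%:E).
Proof.
apply/measurable_EFinP.
have mB (c : 'I_d) : measurable_fun [set: (borelV R d * borelV R d)%type]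
    (fun z : borelV R d * borelV R d => (z.1 - z.2)%R c ord0).
  have := measurable_funB
    (measurableT_comp (measurable_coord c)
      (@measurable_fst _ _ (borelV R d) (borelV R d)))
    (measurableT_comp (measurable_coord c)
      (@measurable_snd _ _ (borelV R d) (borelV R d))).
  by apply: eq_measurable_fun => z _; rewrite /= !mxE.
under eq_fun do rewrite sqr_enorm.
by apply: measurable_sum => c; exact: measurable_funM.
Qed.

(** The coupling that matches the j-th atom of one empirical measure with the
    j-th atom of the other. *)
Definition empirical_pair x y : set (borelV R d * borelV R d)%type -> \bar R :=
  mscale ((N.+1%:R^-1 : R)%:nng)%R
    (msum (fun j : nat => \d_((x (inord j), y (inord j))
       : (borelV R d * borelV R d)%type)) N.+1).

HB.instance Definition _ x y := Measure.on (empirical_pair x y).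

Lemma empirical_pair_setT x y : empirical_pair x y setT = 1.
Proof.
rewrite /empirical_pair /mscale /= /msum/=.
under eq_bigr do rewrite diracT.
by rewrite sumEFin big_const_ord iter_addr_0 -EFinM mulVf// pnatr_eq0.
Qed.

HB.instance Definition _ x y :=
  Measure_isProbability.Build _ _ _ (empirical_pair x y) (empirical_pair_setT x y).

Lemma integral_empirical_pair x y (f : borelV R d * borelV R d -> \bar R) :
  measurable_fun setT f -> (forall z, 0 <= f z) ->
  \int[empirical_pair x y]_z f z = (N.+1%:R^-1)%:E * \sum_j f (x j, y j).
Proof.
move=> mf f0.
rewrite ge0_integral_mscale// ge0_integral_measure_sum//=.
congr (_ * _); apply: eq_bigr => j _.
by rewrite integral_dirac// diracT mul1e inord_val.
Qed.

Lemma integral_empirical x (f : borelV R d -> \bar R) :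
  measurable_fun setT f -> (forall z, 0 <= f z) ->
  \int[empirical x]_z f z = (N.+1%:R^-1)%:E * \sum_j f (x j).
Proof.
move=> mf f0.
rewrite ge0_integral_mscale// ge0_integral_measure_sum//=.
congr (_ * _); apply: eq_bigr => j _.
by rewrite integral_dirac// diracT mul1e inord_val.
Qed.

Lemma moment2_empirical x :
  (moment2 (empirical_P2 x) ^+ 2 = N.+1%:R^-1 * \sum_j enorm (x j) ^+ 2)%R.
Proof.
rewrite /moment2 /= integral_empirical; last 2 first.
- by apply/measurable_EFinP; exact: measurable_sqr_enorm.
- by move=> z; rewrite lee_fin sqr_ge0.
rewrite sumEFin -EFinM/= sqr_sqrtr// mulr_ge0//.
by apply: sumr_ge0 => j _; exact: sqr_ge0.
Qed.

Lemma wasserstein2_le_coupling (mu nu : P2 R d)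
    (pi : probability (borelV R d * borelV R d)%type R) (c : R) :
  coupling mu nu pi ->
  \int[pi]_z (enorm (z.1 - z.2)%R ^+ 2)%:E = c%:E ->
  (wasserstein2 mu nu ^+ 2 <= c)%R.
Proof.
move=> cpl ic.
set S := [set \int[pi]_z (enorm (z.1 - z.2)%R ^+ 2)%:E | pi in coupling mu nu].
have S0 : lbound S 0.
  by move=> _ [pi' _ <-]; apply: integral_ge0 => z _; rewrite lee_fin sqr_ge0.
have i0 : 0 <= ereal_inf S by exact: le_ereal_inf_tmp.
have iS : ereal_inf S <= c%:E by rewrite -ic; apply: ereal_inf_lbound; exists pi.
rewrite /wasserstein2 -/S sqr_sqrtr ?fine_ge0//.
by rewrite -lee_fin fineK// ge0_fin_numE// (le_lt_trans iS)// ltry.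
Qed.

Lemma empirical_pair_coupling x y :
  (forall A : set (borelV R d), empirical_pair x y (A `*` setT) = empirical x A) /\
  (forall A : set (borelV R d), empirical_pair x y (setT `*` A) = empirical y A).
Proof.
split=> A; rewrite /empirical_pair /empirical /mscale/= /msum/=; congr (_ * _);
  apply: eq_bigr => j _; rewrite !diracE; congr (_%:R)%:E; congr nat_of_bool.
  by apply/idP/idP => /set_mem => [[+ _]|?]; [move/mem_set|apply/mem_set; split].
by apply/idP/idP => /set_mem => [[_ +]|?]; [move/mem_set|apply/mem_set; split].
Qed.

Lemma empirical_pair_cost x y :
  \int[empirical_pair x y]_z (enorm (z.1 - z.2)%R ^+ 2)%:E
  = (N.+1%:R^-1 * \sum_j enorm (x j - y j) ^+ 2)%:E.
Proof.
rewrite integral_empirical_pair.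
- by rewrite sumEFin -EFinM.
- exact: measurable_sqr_enormB.
- by move=> z; rewrite lee_fin sqr_ge0.
Qed.

Lemma wasserstein2_empirical_le x y :
  (wasserstein2 (empirical_P2 x) (empirical_P2 y) ^+ 2
   <= N.+1%:R^-1 * \sum_j enorm (x j - y j) ^+ 2)%R.
Proof.
have [c1 c2] := empirical_pair_coupling x y.
apply: (wasserstein2_le_coupling (pi := empirical_pair x y)).
  by split=> A _; [exact: c1|exact: c2].
exact: empirical_pair_cost.
Qed.

(** The Dirac mass at 0 is the empirical measure of N+1 atoms at 0. *)
Lemma wasserstein2_empirical_dirac0_le x :
  (wasserstein2 (empirical_P2 x) (dirac_P2 0) ^+ 2
   <= N.+1%:R^-1 * \sum_j enorm (x j) ^+ 2)%R.
Proof.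
have [c1 c2] := empirical_pair_coupling x (fun=> 0%R).
apply: (wasserstein2_le_coupling (pi := empirical_pair x (fun=> 0%R))).
  split=> A _; first exact: c1.
  rewrite [LHS]c2 /empirical /mscale/= /msum/= sumEFin big_const_ord iter_addr_0.
  by rewrite -EFinM -[X in (_ * X)%R]mulr_natl mulrA mulVf ?mul1r// pnatr_eq0.
rewrite empirical_pair_cost; congr (_ * _)%:E.
by apply: eq_bigr => j _; rewrite subr0.
Qed.

End empirical_wasserstein.

(** * Measurability through rational points *)

Section matrix_density.
Context {R : realType} {a b : nat}.
Implicit Types x y z : 'M[R]_(a, b).

Lemma sqr_hsnormD_le x y :
  hsnorm (x + y) ^+ 2 <= 2 * hsnorm x ^+ 2 + 2 * hsnorm y ^+ 2.
Proof.
rewrite !sqr_hsnorm !mulr_sumr -big_split; apply: ler_sum => l _.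
rewrite !mulr_sumr -big_split; apply: ler_sum => c _ /=.
rewrite mxE -subr_ge0; have := sqr_ge0 (x c l - y c l).
by congr (0 <= _); ring.
Qed.

Lemma hsnormN x : hsnorm (- x) ^+ 2 = hsnorm x ^+ 2.
Proof.
rewrite !sqr_hsnorm; apply: eq_bigr => l _; apply: eq_bigr => c _.
by rewrite mxE sqrrN.
Qed.

Lemma entry_le_hsnorm x i j : x i j ^+ 2 <= hsnorm x ^+ 2.
Proof.
rewrite sqr_hsnorm (bigD1 j)//= (bigD1 i)//= -addrA lerDl.
rewrite addr_ge0//; apply: sumr_ge0 => k _; first exact: sqr_ge0.
by apply: sumr_ge0 => l _; exact: sqr_ge0.
Qed.

(** Approximate each entry within r; the bound r^2 <= r for r <= 1 makes the
    squared error linear in r. *)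
Lemma rational_matrix_dense x (e : R) : 0 < e ->
  exists q : 'M[rat]_(a, b), hsnorm (map_mx ratr q - x) ^+ 2 < e.
Proof.
move=> e0; pose D := (a * b).+1%:R : R.
pose r := Num.min 1 (e / D).
have D0 : 0 < D by rewrite ltr0n.
have r0 : 0 < r by rewrite lt_min ltr01 divr_gt0.
have H i j : exists q : rat, `|ratr q - x i j| < r.
  have /rat_in_itvoo[q] : x i j - r < x i j + r by lra.
  by rewrite in_itv/= => xq; exists q; rewrite ltr_norml; lra.
have [q Hq] := choice (fun ij : 'I_a * 'I_b => H ij.1 ij.2).
exists (\matrix_(i, j) q (i, j)); rewrite sqr_hsnorm.
apply: (@le_lt_trans _ _ (\sum_(j < b) \sum_(i < a) (e / D))).
  apply: ler_sum => j _; apply: ler_sum => i _; rewrite !mxE.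
  have /ltW Hij := Hq (i, j); rewrite -[X in X <= _]real_normK ?num_real//.
  apply: (@le_trans _ _ (r ^+ 2)).
    by rewrite lerXn2r ?nnegrE ?normr_ge0// ltW.
  apply: (@le_trans _ _ r); last by rewrite /r ge_min lexx orbT.
  by rewrite expr2 ger_pMl// /r ge_min lexx.
rewrite !sumr_const !card_ord -mulrnA -mulr_natr -mulrA gtr_pMr//.
by rewrite mulrC ltr_pdivrMr// mul1r ltr_nat.
Qed.

End matrix_density.

Section measurability_by_rational_approximation.
Context {R : realType} {T : pointedType} (G : set (set T)).
Local Notation TG := (g_sigma_algebraType G).

Lemma measurable_hsnorm_sub a b (Y Z : T -> 'M[R]_(a, b)) :
  (forall i j, measurable_fun [set: TG] (fun w => Y w i j)) ->
  (forall i j, measurable_fun [set: TG] (fun w => Z w i j)) ->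
  measurable_fun [set: TG] (fun w => hsnorm (Y w - Z w) ^+ 2).
Proof.
move=> mY mZ; under eq_fun do rewrite sqr_hsnorm.
apply: measurable_sum => l; apply: measurable_sum => c.
under eq_fun do rewrite !mxE.
by apply: measurable_funX; exact: measurable_funB.
Qed.

(** A superlevel set of g is a countable union of balls with rational centres
    and radii, and each ball pulls back to a measurable set. *)
Lemma measurable_comp_continuous a b (Y : T -> 'M[R]_(a, b)) (g : 'M[R]_(a, b) -> R) :
  (forall i j, measurable_fun [set: TG] (fun w => Y w i j)) ->
  (forall x e, 0 < e -> exists2 r, 0 < r &
     forall z, hsnorm (z - x) ^+ 2 < r -> `|g z - g x| < e) ->
  measurable_fun [set: TG] (fun w => g (Y w)).
Proof.
move=> mY cg.
apply: (measurability _ (RGenOInfty.measurableE R)) => // _ [_ [t ->] <-].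
rewrite setTI.
pose good (i : 'M[rat]_(a, b) * rat) :=
  forall z, hsnorm (z - map_mx ratr i.1) ^+ 2 < ratr i.2 -> t < g z.
pose U (i : 'M[rat]_(a, b) * rat) : set TG :=
  if `[< good i >] then [set w | hsnorm (Y w - map_mx ratr i.1) ^+ 2 < ratr i.2]
  else set0.
rewrite (_ : _ @^-1` _ = \bigcup_(i in setT) U i).
  apply: countable_bigcupT_measurable => // i; rewrite /U.
  case: asboolP => // _.
  have mq k l : measurable_fun [set: TG] (fun=> map_mx (ratr : rat -> R) i.1 k l).
    exact: measurable_cst.
  have := measurable_hsnorm_sub mY mq measurableT
    (measurable_itv `]-oo, (ratr i.2 : R)[).
  by rewrite setTI; congr (measurable _); apply/seteqP; split => w /=;
    rewrite in_itv.
apply/seteqP; split => w /=.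
  rewrite in_itv/= andbT -subr_gt0 => tg.
  have [r r0 Hr] := cg (Y w) _ tg.
  have /rat_in_itvoo[e] : 0 < r / 4 by lra.
  rewrite in_itv/= => /andP[e0 er].
  have [q Hq] := rational_matrix_dense (Y w) e0.
  exists (q, e) => //; rewrite /U; case: asboolP => [_|bad] /=.
    by rewrite -hsnormN opprB.
  exfalso; apply: bad => z /= Hz.
  have : `|g z - g (Y w)| < g (Y w) - t.
    apply: Hr; have -> : z - Y w = (z - map_mx ratr q) + (map_mx ratr q - Y w).
      by rewrite addrA subrK.
    by apply: (le_lt_trans (sqr_hsnormD_le _ _)); lra.
  by rewrite ltr_norml => /andP[+ _]; lra.
move=> [i _]; rewrite /U; case: asboolP => // Hgood /= Hi.
by rewrite in_itv/= andbT; exact: Hgood.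
Qed.

(** Y solves F Y = Z, where the residual of a point q controls the distance
    from q to Y; hence Y is located by the rational points at which the residual
    is small. This avoids building a measurable inverse of F. The equation only
    needs to hold on D, because every subset of the complement of D is
    measurable. *)
Lemma measurable_implicit d (D : set T) (Y Z : T -> 'cV[R]_d)
    (F : 'cV[R]_d -> T -> 'cV[R]_d) :
  (forall A, A `<=` ~` D -> <<s G >> A) ->
  (forall c, measurable_fun [set: TG] (fun w => Z w c ord0)) ->
  (forall q c, measurable_fun [set: TG] (fun w => F q w c ord0)) ->
  (forall w, D w -> forall q,
     hsnorm (q - Y w) ^+ 2 <= hsnorm (F q w - Z w) ^+ 2) ->
  (forall w, D w -> forall e, 0 < e -> exists2 r, 0 < r & forall q,
     hsnorm (q - Y w) ^+ 2 < r -> hsnorm (F q w - Z w) ^+ 2 < e) ->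
  forall c, measurable_fun [set: TG] (fun w => Y w c ord0).
Proof.
move=> nullD mZ mF expand cont c.
apply: (measurability _ (RGenOInfty.measurableE R)) => // _ [_ [t ->] <-].
rewrite setTI; set A := _ @^-1` _.
pose U (i : 'cV[rat]_d * rat) : set TG :=
  if (0 < (ratr i.2 : R)) && (t < ratr (i.1 c ord0) - ratr i.2)
  then [set w | hsnorm (F (map_mx ratr i.1) w - Z w) ^+ 2 < ratr i.2 ^+ 2]
  else set0.
have mD : measurable (D : set TG).
  by rewrite -[D]setCK; apply: measurableC; exact: nullD.
rewrite (_ : A = (A `&` ~` D) `|` (\bigcup_(i in setT) U i `&` D)).
  apply: measurableU; first by apply: nullD => w [].
  apply: measurableI => //; apply: countable_bigcupT_measurable => // i.
  rewrite /U; case: ifP => // _.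
  have mF1 k l : measurable_fun [set: TG] (fun w => F (map_mx ratr i.1) w k l).
    by rewrite ord1.
  have mZ1 k l : measurable_fun [set: TG] (fun w => Z w k l) by rewrite ord1.
  have := measurable_hsnorm_sub mF1 mZ1 measurableT
    (measurable_itv `]-oo, (ratr i.2 ^+ 2 : R)[).
  by rewrite setTI; congr (measurable _); apply/seteqP; split => w /=;
    rewrite in_itv.
apply/seteqP; split => w.
  have [Dw Aw|Dw Aw] := pselect (D w); last by left.
  right; split => //.
  move: Aw; rewrite /A/= in_itv/= andbT => Aw.
  have /rat_in_itvoo[e] : 0 < (Y w c ord0 - t) / 2 by lra.
  rewrite in_itv/= => /andP[e0 et].
  have e20 : 0 < (ratr e : R) ^+ 2 by rewrite exprn_gt0.
  have [r r0 Hr] := cont w Dw _ e20.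
  have m0 : 0 < Num.min r (ratr e ^+ 2) by rewrite lt_min r0.
  have [q] := rational_matrix_dense (Y w) m0; rewrite lt_min => /andP[qr qe].
  exists (q, e) => //; rewrite /U/= e0.
  have := le_lt_trans (entry_le_hsnorm _ c ord0) qe; rewrite !mxE.
  move=> qYe; have -> /= : t < ratr (q c ord0) - ratr e.
    have : `|ratr (q c ord0) - Y w c ord0| < ratr e.
      by rewrite -ltr_sqr ?nnegrE ?normr_ge0 ?(ltW e0)// real_normK ?num_real.
    by rewrite ltr_norml => /andP[+ _]; lra.
  exact: Hr.
move=> [[]//|[[i _] + Dw]]; rewrite /U; case: ifP => // /andP[e0 te] /= Hi.
rewrite /A/= in_itv/= andbT.
have := le_lt_trans (le_trans (entry_le_hsnorm _ c ord0) (expand w Dw _)) Hi.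
rewrite !mxE => qYe.
have : `|ratr (i.1 c ord0) - Y w c ord0| < ratr i.2.
  by rewrite -ltr_sqr ?nnegrE ?normr_ge0 ?(ltW e0)// real_normK ?num_real.
by rewrite ltr_norml => /andP[_]; lra.
Qed.

End measurability_by_rational_approximation.

Section norms.
Context {R : realType}.

Lemma hsnorm_cV d (x : 'cV[R]_d) : hsnorm x ^+ 2 = enorm x ^+ 2.
Proof.
by rewrite sqr_hsnorm big_ord1 sqr_enorm; apply: eq_bigr => c _; rewrite expr2.
Qed.

Lemma sum_enorm_col d n (x : 'M[R]_(d, n)) :
  \sum_j enorm (col j x) ^+ 2 = hsnorm x ^+ 2.
Proof.
rewrite sqr_hsnorm; apply: eq_bigr => j _; rewrite sqr_enorm.
by apply: eq_bigr => c _; rewrite !mxE expr2.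
Qed.

Lemma sqr_enormD_le d (x y : 'cV[R]_d) :
  enorm (x + y) ^+ 2 <= 2 * enorm x ^+ 2 + 2 * enorm y ^+ 2.
Proof. by rewrite -!hsnorm_cV sqr_hsnormD_le. Qed.

Lemma measurable_comp_lipschitz (T : pointedType) (G : set (set T)) a b
    (Y : T -> 'M[R]_(a, b)) (g : 'M[R]_(a, b) -> R) (L : R) : 0 <= L ->
  (forall i j, measurable_fun [set: g_sigma_algebraType G] (fun w => Y w i j)) ->
  (forall z x, (g z - g x) ^+ 2 <= L * hsnorm (z - x) ^+ 2) ->
  measurable_fun [set: g_sigma_algebraType G] (fun w => g (Y w)).
Proof.
move=> L0 mY gL; apply: measurable_comp_continuous => // x e e0.
have L1 : 0 < L + 1 by lra.
exists (e ^+ 2 / (L + 1)); first by rewrite divr_gt0// exprn_gt0.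
move=> z; rewrite ltr_pdivlMr// => H.
rewrite -ltr_sqr ?nnegrE ?normr_ge0 ?(ltW e0)// real_normK ?num_real//.
apply: le_lt_trans (gL z x) _; apply: le_lt_trans H.
by rewrite mulrC ler_wpM2l ?sqr_ge0//; lra.
Qed.

End norms.

(** * Regularity of the coefficients along particle systems *)

Section coefficients.
Context {R : realType} {d m N : nat}.
Variables (b : 'cV[R]_d -> P2 R d -> 'cV[R]_d)
  (sigma : 'cV[R]_d -> P2 R d -> 'M[R]_(d, m)).
Variables (K1 K2 L1 kappa q0 a1 a2 Lsigma : R).
Hypothesis hA1 : A1 b sigma K1 K2.
Hypothesis hA2 : A2 b L1 kappa.
Hypothesis hA5 : A5 sigma q0 a1 a2 Lsigma.

Local Notation emp x := (empirical_P2 (fun j : 'I_N.+1 => col j x)).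

Lemma wasserstein2_empirical_self (x : 'I_N.+1 -> 'cV[R]_d) :
  wasserstein2 (empirical_P2 x) (empirical_P2 x) ^+ 2 = 0.
Proof.
apply/eqP; rewrite eq_le sqr_ge0 andbT.
apply: le_trans (wasserstein2_empirical_le x x) _.
rewrite big1 ?mulr0// => j _; rewrite subrr sqr_enorm /inner big1// => c _.
by rewrite mxE mul0r.
Qed.

Lemma wasserstein2_empirical_hsnorm (z x : 'M[R]_(d, N.+1)) :
  wasserstein2 (emp z) (emp x) ^+ 2 <= hsnorm (z - x) ^+ 2.
Proof.
apply: le_trans (wasserstein2_empirical_le _ _) _.
under eq_bigr do rewrite -linearB/=.
rewrite sum_enorm_col ler_piMl ?sqr_ge0//.
by rewrite invf_le1 ?ler1n// ltr0n.
Qed.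

(** With the spatial argument frozen, (A2) is a Lipschitz bound in the positions
    of the particles, since matching particles bounds the Wasserstein distance. *)
Lemma drift_lipschitz_measure q c (z x : 'M[R]_(d, N.+1)) :
  (b q (emp z) c ord0 - b q (emp x) c ord0) ^+ 2 <= L1 * hsnorm (z - x) ^+ 2.
Proof.
have [L10 _ /(_ q q (emp z) (emp x))] := hA2.
have -> : enorm (q - q) ^+ 2 = 0.
  by rewrite subrr sqr_enorm /inner big1// => i _; rewrite mxE mul0r.
rewrite mulr0 add0r => H.
have -> : b q (emp z) c ord0 - b q (emp x) c ord0 =
    (b q (emp z) - b q (emp x)) c ord0.
  by rewrite !mxE.
apply: le_trans (entry_le_hsnorm _ c ord0) _; rewrite hsnorm_cV.
apply: le_trans H _; rewrite ler_wpM2l ?(ltW L10)//.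
exact: wasserstein2_empirical_hsnorm.
Qed.

Lemma diffusion_lipschitz i c l (z x : 'M[R]_(d, N.+1)) :
  (sigma (col i z) (emp z) c l - sigma (col i x) (emp x) c l) ^+ 2
  <= 2 * Lsigma * hsnorm (z - x) ^+ 2.
Proof.
have [L0 _ /(_ (col i z) (col i x) (emp z) (emp x)) H] := hA5.
have -> : sigma (col i z) (emp z) c l - sigma (col i x) (emp x) c l =
    (sigma (col i z) (emp z) - sigma (col i x) (emp x)) c l by rewrite !mxE.
apply: le_trans (entry_le_hsnorm _ c l) _; apply: le_trans H _.
rewrite mulrAC -[2 * _ * Lsigma]mulrC ler_wpM2l ?(ltW L0)// mulrDl mul1r.
rewrite -linearB/= lerD ?wasserstein2_empirical_hsnorm//.
rewrite -sum_enorm_col (bigD1 i)//= lerDl.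
by apply: sumr_ge0 => j _; exact: sqr_ge0.
Qed.

(** By (A1) the drift is dissipative in space: its inner product with q - y is
    nonpositive, so subtracting a multiple of it can only push the images apart. *)
Lemma resolvent_expansive (h : R) q y (mu : P2 R d) : 0 <= h ->
  wasserstein2 mu mu ^+ 2 = 0 ->
  hsnorm (q - y) ^+ 2 <= hsnorm ((q - h *: b q mu) - (y - h *: b y mu)) ^+ 2.
Proof.
move=> h0 mu0; have [_ _ K10 /(_ q y mu mu) H] := hA1.
rewrite mu0 mulr0 addr0 in H.
set v := b q mu - b y mu in H *.
have ip : inner (q - y) v <= 0.
  have s0 := sqr_ge0 (hsnorm (sigma q mu - sigma y mu)).
  have e0 : 0 <= K1 * enorm (q - y) ^+ 2 by rewrite mulr_ge0 ?sqr_ge0// ltW.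
  lra.
have -> : (q - h *: b q mu) - (y - h *: b y mu) = (q - y) + (- h) *: v.
  by apply/colP => c; rewrite !mxE; ring.
rewrite !hsnorm_cV sqr_enormD.
have : 0 <= - inner (q - y) v * h by rewrite mulr_ge0// oppr_ge0.
have : 0 <= enorm v ^+ 2 * (- h) ^+ 2 by rewrite mulr_ge0 ?sqr_ge0.
lra.
Qed.

(** (A2) is a Lipschitz bound with a constant that grows polynomially; on the
    unit ball around y this constant is bounded, with rho a bound for |q|. *)
Lemma resolvent_continuous (h : R) y (mu : P2 R d) (e : R) : 0 < e ->
  wasserstein2 mu mu ^+ 2 = 0 ->
  exists2 r, 0 < r & forall q, hsnorm (q - y) ^+ 2 < r ->
    hsnorm ((q - h *: b q mu) - (y - h *: b y mu)) ^+ 2 < e.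
Proof.
move=> e0 mu0; have [L10 k1 H] := hA2.
pose rho := Num.sqrt (2 * enorm y ^+ 2 + 2).
pose C := 2 + 2 * (h ^+ 2 *
  (L1 * (1 + rho `^ (2 * kappa - 2) + enorm y `^ (2 * kappa - 2)))).
have C0 : 0 < C.
  rewrite /C ltr_pwDl// mulr_ge0// mulr_ge0 ?sqr_ge0// mulr_ge0 ?(ltW L10)//.
  by rewrite !addr_ge0 ?powR_ge0.
exists (Num.min 1 (e / C)); first by rewrite lt_min ltr01 divr_gt0.
move=> q; rewrite lt_min ltr_pdivlMr// => /andP[q1 qe].
apply: le_lt_trans qe; rewrite !hsnorm_cV in q1 *.
have -> : (q - h *: b q mu) - (y - h *: b y mu) =
    (q - y) + (- h) *: (b q mu - b y mu).
  by apply/colP => c; rewrite !mxE; ring.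
apply: le_trans (sqr_enormD_le _ _) _.
have -> : enorm (- h *: (b q mu - b y mu)) ^+ 2 =
    h ^+ 2 * enorm (b q mu - b y mu) ^+ 2.
  by rewrite !sqr_enorm innerZl innerZr; ring.
have qrho : enorm q <= rho.
  rewrite /rho -[enorm q]ger0_norm ?enorm_ge0// -sqrtr_sqr ler_wsqrtr//.
  rewrite -{1}[q](subrK y); apply: le_trans (sqr_enormD_le _ _) _; lra.
have := H q y mu mu; rewrite mu0 addr0 => {}H.
have pw : enorm q `^ (2 * kappa - 2) <= rho `^ (2 * kappa - 2).
  by apply: ge0_ler_powR; rewrite ?nnegrE ?enorm_ge0 ?sqrtr_ge0//; lra.
have : L1 * ((1 + enorm q `^ (2 * kappa - 2) + enorm y `^ (2 * kappa - 2)) *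
    enorm (q - y) ^+ 2) <=
    L1 * (1 + rho `^ (2 * kappa - 2) + enorm y `^ (2 * kappa - 2))
    * enorm (q - y) ^+ 2.
  rewrite -mulrA ler_wpM2l ?(ltW L10)// ler_wpM2r ?sqr_ge0//; lra.
move=> /(le_trans H) {}H.
have := ler_wpM2l (sqr_ge0 h) H.
rewrite /C; lra.
Qed.

End coefficients.

(** * The scheme is adapted *)

Section scheme.
Context {R : realType} {d m : nat} {disp : measure_display}
  {T : measurableType disp} {P : probability T R}.
Variables (F : R -> set (set T)) (W : T -> pathV R m) (X0 : T -> borelV R d).
Variables (b : 'cV[R]_d -> P2 R d -> 'cV[R]_d)
  (sigma : 'cV[R]_d -> P2 R d -> 'M[R]_(d, m)).
Variables (K1 K2 L1 kappa q0 a1 a2 Lsigma : R).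
Hypothesis hF : complete_filtration P F.
Hypothesis hW : brownian_motion P F W.
Hypothesis hX0 : F_measurable (F 0) X0.
Hypothesis hA1 : A1 b sigma K1 K2.
Hypothesis hA2 : A2 b L1 kappa.
Hypothesis hA5 : A5 sigma q0 a1 a2 Lsigma.
Variables (N : nat) (Wc : 'I_N.+1 -> T -> pathV R m)
  (X0c : 'I_N.+1 -> T -> borelV R d).
Hypothesis hcopies : iid_copies P (fun w => (W w, X0 w))
  (fun j w => (Wc j w, X0c j w)).
Variables (h : R) (X : nat -> 'I_N.+1 -> T -> borelV R d).
Hypothesis h0 : 0 <= h.
Hypothesis hX : backward_euler P b sigma h Wc X0c X.

Definition scheme_past (k : nat) : set (set T) :=
  copies_past (P := P) F W X0 Wc X0c (k%:R * h).

Local Notation TG k := (g_sigma_algebraType (scheme_past k)).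

Lemma step_time_ge0 k : 0 <= k%:R * h. Proof. by rewrite mulr_ge0. Qed.

Lemma step_time_leS k : k%:R * h <= k.+1%:R * h.
Proof. by rewrite ler_wpM2r// ler_nat. Qed.

Lemma negligible_scheme_past k A : P.-negligible A -> <<s scheme_past k >> A.
Proof.
move=> nA; apply: sub_sigma_algebra.
exact: (negligible_copies_past W X0 Wc X0c hF (step_time_ge0 k)).
Qed.

Lemma scheme_past_homo k : scheme_past k `<=` <<s scheme_past k.+1 >>.
Proof.
move=> A Ak; apply: sub_sigma_algebra.
exact: (copies_past_homo hF (step_time_ge0 k) (step_time_leS k) Ak).
Qed.

(** The positions as a single matrix, so that measurability of functions of the
    whole particle system reduces to functions of finitely many entries. *)
Definition particles k w : 'M[R]_(d, N.+1) :=
  \matrix_(c, j) (X k j w : 'cV[R]_d) c ord0.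

Lemma col_particles k w j : col j (particles k w) = X k j w.
Proof. by apply/colP => c; rewrite !mxE. Qed.

Lemma empirical_particles k w :
  empirical_P2 (fun j => col j (particles k w)) = empirical_P2 (fun j => X k j w).
Proof. by congr empirical_P2; apply/funext => j; exact: col_particles. Qed.

Section one_step.
Variable k : nat.
Hypothesis mXk : forall i c, measurable_fun [set: TG k]
  (fun w => (X k i w : 'cV[R]_d) c ord0).

Let mY k' : (forall i c, measurable_fun [set: TG k']
    (fun w => (X k i w : 'cV[R]_d) c ord0)) ->
  forall c j, measurable_fun [set: TG k'] (fun w => particles k w c j).
Proof. by move=> mX c j; under eq_fun do rewrite mxE; exact: mX. Qed.

Lemma measurable_diffusion_coeff i c l : measurable_fun [set: TG k]
  (fun w => sigma (X k i w) (empirical_P2 (fun j => X k j w)) c l).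
Proof.
have L0 : 0 <= 2 * Lsigma by have [L0 _ _] := hA5; rewrite mulr_ge0// ltW.
have := measurable_comp_lipschitz L0 (mY mXk) (diffusion_lipschitz hA5 i c l).
by under eq_fun do rewrite col_particles empirical_particles.
Qed.

Lemma measurable_drift_coeff q c : measurable_fun [set: TG k]
  (fun w => b q (empirical_P2 (fun j => X k j w)) c ord0).
Proof.
have L0 : 0 <= L1 by have [/ltW] := hA2.
have := measurable_comp_lipschitz L0 (mY mXk) (drift_lipschitz_measure hA2 q c).
by under eq_fun do rewrite empirical_particles.
Qed.

(** The implicit step F X = Z has a residual that dominates the distance to the
    solution by [resolvent_expansive], and its right side depends only on the
    past and on the new increment. *)
Lemma measurable_next_particle i c : measurable_fun [set: TG k.+1]
  (fun w => (X k.+1 i w : 'cV[R]_d) c ord0).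
Proof.
pose mu w := empirical_P2 (fun j => X k j w).
pose Z w : 'cV[R]_d := X k i w + sigma (X k i w) (mu w)
  *m increment (Wc i) (k%:R * h) (k.+1%:R * h) w.
pose D := [set w | (X k.+1 i w : 'cV[R]_d) - h *: b (X k.+1 i w) (mu w) = Z w].
have up (f : T -> R) :
    measurable_fun [set: TG k] f -> measurable_fun [set: TG k.+1] f.
  by apply: measurable_fun_g_sigma_sub; exact: scheme_past_homo.
have mumu w : wasserstein2 (mu w) (mu w) ^+ 2 = 0.
  exact: wasserstein2_empirical_self.
apply: (@measurable_implicit _ _ _ _ D _ Z (fun q w => q - h *: b q (mu w))).
- move=> A AD; apply: negligible_scheme_past.
  have [_ _ /(_ k i)] := hX; apply: negligibleS => w /AD; apply: contra_not => /= eX.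
  by rewrite /D/= /Z /mu {1}eX [X in X - _]addrAC addrK.
- move=> c'; rewrite /Z; under eq_fun do rewrite mxE mxE.
  apply: measurable_funD; first by apply: up; exact: mXk.
  apply: measurable_sum => l; apply: measurable_funM.
    by apply: up; exact: measurable_diffusion_coeff.
  exact: (measurable_increment_copies hF hW hcopies i l
    (step_time_ge0 k) (step_time_leS k)).
- move=> q c'; under eq_fun do rewrite !mxE.
  apply: measurable_funB => //; apply: measurable_funM => //.
  by apply: up; exact: measurable_drift_coeff.
- by move=> w Dw q; rewrite -Dw; exact: (resolvent_expansive hA1).
- move=> w Dw e e0.
  have [r r0 H] := resolvent_continuous hA2 h (X k.+1 i w) e0 (mumu w).
  by exists r => // q /H; rewrite -Dw.
Qed.

End one_step.

Lemma measurable_particle k i c : measurable_fun [set: TG k]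
  (fun w => (X k i w : 'cV[R]_d) c ord0).
Proof.
elim: k i c => [|k IH] i c; last exact: measurable_next_particle.
pose D := [set w | X 0%N i w = X0c i w].
apply: (@measurable_implicit _ _ _ _ D _ (fun w => X0c i w) (fun q w => q)) => //.
- move=> A AD; apply: negligible_scheme_past.
  by have [_ /(_ i) + _] := hX; apply: negligibleS.
- move=> c'; rewrite /scheme_past mul0r.
  exact: (measurable_initial_copies hF hX0 hcopies).
- by move=> w Dw q; rewrite Dw.
- by move=> w Dw e e0; exists e => // q; rewrite Dw.
Qed.

Lemma increment_independent k i (A : set T) (B : 'I_m -> set R) : 0 < h ->
  <<s scheme_past k >> A -> (forall l, measurable (B l)) ->
  (P (A `&` [set w | forall l, B l
      ((increment (Wc i) (k%:R * h) (k.+1%:R * h) w : 'cV[R]_m) l ord0)])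
   = P A * \prod_l normal_prob 0 (Num.sqrt h) (B l))%E.
Proof.
move=> hp sA mB.
have kh : k%:R * h < k.+1%:R * h by rewrite ltr_pM2r// ltr_nat.
have eh : k.+1%:R * h - k%:R * h = h by rewrite -mulrBl -natrB// subSnn mul1r.
rewrite -[X in normal_prob 0 (Num.sqrt X)]eh.
exact: (increment_copies_independent hF hW hcopies i (step_time_ge0 k) kh sA mB).
Qed.

End scheme.

(** * Convexity of powers *)

Section jensen_powers.
Context {R : realDomainType}.

(** Convexity of the power on the half-line, by induction: multiplying the
    inequality by u leaves the surplus (n+1) v^n (u - v)^2. *)
Lemma power_above_tangent (u v : R) n : 0 <= u -> 0 <= v ->
  v ^+ n.+1 + n.+1%:R * v ^+ n * (u - v) <= u ^+ n.+1.
Proof.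
move=> u0 v0; elim: n => [|n IH]; first by rewrite expr0 !expr1 !mul1r subrKC.
rewrite [leRHS]exprS; apply: le_trans (ler_wpM2l u0 IH).
rewrite -subr_ge0.
have -> : u * (v ^+ n.+1 + n.+1%:R * v ^+ n * (u - v)) -
    (v ^+ n.+2 + n.+2%:R * v ^+ n.+1 * (u - v)) =
    n.+1%:R * v ^+ n * (u - v) ^+ 2.
  by rewrite [n.+2%:R]mulrSr !exprS; ring.
by rewrite mulr_ge0 ?sqr_ge0// mulr_ge0// exprn_ge0.
Qed.

(** Sum the tangent inequality at the barycentre. *)
Lemma jensen_power (I : finType) (p u : I -> R) n :
  (forall i, 0 <= p i) -> (forall i, 0 <= u i) -> \sum_i p i = 1 ->
  (\sum_i p i * u i) ^+ n.+1 <= \sum_i p i * u i ^+ n.+1.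
Proof.
move=> p0 u0 p1; set v := \sum_i p i * u i.
have v0 : 0 <= v by apply: sumr_ge0 => i _; exact: mulr_ge0.
apply: (@le_trans _ _
    (\sum_i p i * (v ^+ n.+1 + n.+1%:R * v ^+ n * (u i - v)))); last first.
  by apply: ler_sum => i _; rewrite ler_wpM2l// power_above_tangent.
set c := n.+1%:R * v ^+ n.
have -> : \sum_i p i * (v ^+ n.+1 + c * (u i - v)) =
    \sum_i (p i * v ^+ n.+1 + (c * (p i * u i) - c * v * p i)).
  by apply: eq_bigr => i _; ring.
rewrite big_split sumrB -mulr_suml -!mulr_sumr p1 -/v.
by rewrite /= mul1r mulr1 subrr addr0.
Qed.

Lemma jensen_power3 (p1 p2 p3 u1 u2 u3 : R) n :
  0 <= p1 -> 0 <= p2 -> 0 <= p3 -> p1 + p2 + p3 = 1 ->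
  0 <= u1 -> 0 <= u2 -> 0 <= u3 ->
  (p1 * u1 + p2 * u2 + p3 * u3) ^+ n.+1
  <= p1 * u1 ^+ n.+1 + p2 * u2 ^+ n.+1 + p3 * u3 ^+ n.+1.
Proof.
move=> p10 p20 p30 psum u10 u20 u30.
have := @jensen_power 'I_3 (fun i => nth 0 [:: p1; p2; p3] i)
  (fun i => nth 0 [:: u1; u2; u3] i) n.
rewrite !big_ord_recl !big_ord0 /= !addr0 !addrA; apply => //.
  by case=> [[|[|[|]]]].
by case=> [[|[|[|]]]].
Qed.

End jensen_powers.

(** * Dissipation of one implicit step *)

Section growth.
Context {R : realType} {d m : nat}.
Variables (b : 'cV[R]_d -> P2 R d -> 'cV[R]_d)
  (sigma : 'cV[R]_d -> P2 R d -> 'M[R]_(d, m)).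
Variables (q0 a1 a2 qstar C Lsigma : R).
Hypothesis hA4 : A4 b sigma q0 a1 a2 qstar C.
Hypothesis hA5 : A5 sigma q0 a1 a2 Lsigma.
Hypothesis q0_ge1 : 1 <= q0.

Lemma diffusion_growth (N : nat) (x : 'cV[R]_d) (y : 'I_N.+1 -> 'cV[R]_d) :
  hsnorm (sigma x (empirical_P2 y)) ^+ 2 <=
  2 * Lsigma * (enorm x ^+ 2 + N.+1%:R^-1 * \sum_j enorm (y j) ^+ 2)
  + 2 * hsnorm (sigma 0 (dirac_P2 0)) ^+ 2.
Proof.
have [L0 _ /(_ x 0 (empirical_P2 y) (dirac_P2 0))] := hA5.
rewrite subr0 => H.
rewrite -[X in hsnorm X ^+ 2 <= _](subrK (sigma 0 (dirac_P2 0))).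
apply: le_trans (sqr_hsnormD_le _ _) _; rewrite lerD2r -mulrA ler_wpM2l//.
apply: le_trans H _; rewrite ler_wpM2l ?(ltW L0)// lerD2l.
exact: wasserstein2_empirical_dirac0_le.
Qed.

(** Expanding |x - h b|^2 and dropping h^2 |b|^2, the cross term
    - 2 h <x, b> is bounded below by (A4). *)
Lemma implicit_step_dissipation (N : nat) (h : R) (x z : 'cV[R]_d)
    (y : 'I_N.+1 -> 'cV[R]_d) : 0 <= h ->
  x - h *: b x (empirical_P2 y) = z ->
  (1 + a1 * h) * enorm x ^+ 2 <=
  enorm z ^+ 2 + (a2 * h * (N.+1%:R^-1 * \sum_j enorm (y j) ^+ 2) + C * h).
Proof.
move=> h0 <-; have [[a20 _ q4 _] /(_ x (empirical_P2 y))] := hA4.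
rewrite moment2_empirical; set S := N.+1%:R^-1 * _; set v := b _ _ => H.
have s0 : 0 <= (qstar - 1) * hsnorm (sigma x (empirical_P2 y)) ^+ 2.
  have q1 : 0 <= qstar - 1 by move: q4 q0_ge1; lra.
  by rewrite mulr_ge0 ?sqr_ge0.
rewrite -scaleNr sqr_enormD.
have H1 : h * (2 * inner x v) <= h * (- a1 * enorm x ^+ 2 + a2 * S + C).
  by rewrite ler_wpM2l//; lra.
have : 0 <= enorm v ^+ 2 * (- h) ^+ 2 by rewrite mulr_ge0 ?sqr_ge0.
lra.
Qed.

End growth.

(** * Propagation of moments *)

(** The bound is an extended real, so that it applies before any moment is
    known to be finite. *)
Lemma integral_convex_combination_le {R : realType} d (T : measurableType d)
    (P : probability T R) (I : finType) (c : I -> R) (u : I -> T -> R)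
    (e g : R) (B : \bar R) :
  (forall j, 0 <= c j) -> (forall j w, 0 <= u j w) ->
  (forall j, measurable_fun setT (u j)) -> 0 <= e -> 0 <= g ->
  \sum_j c j + e = 1 ->
  (forall j, (\int[P]_w (u j w)%:E <= B)%E) -> (g%:E <= B)%E ->
  (\int[P]_w (\sum_j c j * u j w + e * g)%:E <= B)%E.
Proof.
move=> c0 u0 mu e0 g0 ce1 uB gB.
have B0 : (0 <= B)%E by apply: le_trans gB; rewrite lee_fin.
have mcu j : measurable_fun setT (fun w => (c j * u j w)%:E).
  by apply/measurable_EFinP; exact: measurable_funM.
under eq_integral do rewrite EFinD -sumEFin.
rewrite ge0_integralD//; last 3 first.
- by move=> w _; apply: sume_ge0 => j _; rewrite lee_fin mulr_ge0.
- exact: emeasurable_sum.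
- by move=> w _; rewrite lee_fin mulr_ge0.
rewrite [X in (_ + X <= _)%E](_ : _ = (e * g)%:E); last first.
  rewrite integral_cst// -[RHS]mule1; congr (_ * _)%E; exact: probability_setT.
rewrite ge0_integral_sum; [|by []|exact: mcu|]; last first.
  by move=> j w _; rewrite lee_fin mulr_ge0.
apply: (@le_trans _ _ (\sum_j (c j)%:E * B + e%:E * B)%E).
  apply: leeD; last by rewrite EFinM lee_wpmul2l ?lee_fin.
  apply: lee_sum => j _; under eq_integral do rewrite EFinM.
  rewrite ge0_integralZl//.
  - by rewrite lee_wpmul2l ?lee_fin.
  - exact/measurable_EFinP.
  - by move=> w _; rewrite lee_fin.
- by rewrite lee_fin.
have -> : (\sum_j (c j)%:E * B)%E = ((\sum_j (c j)%:E) * B)%E.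
  by rewrite ge0_sume_distrl// => j _; rewrite lee_fin.
rewrite -ge0_muleDl ?lee_fin// ?sume_ge0//; last by move=> j _; rewrite lee_fin.
by rewrite sumEFin -EFinD ce1 mul1e.
Qed.

Section moment_propagation.
Context {R : realType} {d m : nat} {disp : measure_display}
  {T : measurableType disp} {P : probability T R}.
Variables (F : R -> set (set T)) (W : T -> pathV R m) (X0 : T -> borelV R d).
Variables (b : 'cV[R]_d -> P2 R d -> 'cV[R]_d)
  (sigma : 'cV[R]_d -> P2 R d -> 'M[R]_(d, m)).
Variables (K1 K2 L1 kappa q0 a1 a2 qstar C Lsigma : R).
Hypothesis hF : complete_filtration P F.
Hypothesis hW : brownian_motion P F W.
Hypothesis hX0 : F_measurable (F 0) X0.
Hypothesis hA1 : A1 b sigma K1 K2.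
Hypothesis hA2 : A2 b L1 kappa.
Hypothesis hA4 : A4 b sigma q0 a1 a2 qstar C.
Hypothesis hA5 : A5 sigma q0 a1 a2 Lsigma.
Hypothesis q0_ge1 : 1 <= q0.
Variable n : nat.
Hypothesis n_le_q0 : (2 * n.+1)%:R <= q0.

(** With n+1 half of the exponent of the moment, the noise adds at most
    noise_rate * h times |x|^2 and as much of the mean square of the particles
    to the squared norm; the implicit drift multiplies it by 1 + a1 h and
    returns a2 h times the mean square; source collects the constants of both
    growth conditions. What remains of the dissipation is contraction_rate, and
    rest_level is the value of the squared norm at which it balances the
    source. *)
Definition noise_rate : R := (2 * n.+1).-1%:R * (2 * Lsigma).
Definition source : R :=
  C + (2 * n.+1).-1%:R * (2 * hsnorm (sigma 0 (dirac_P2 0)) ^+ 2).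
Definition contraction_rate : R := a1 - a2 - 2 * noise_rate.
Definition rest_level : R := source / contraction_rate.

Lemma noise_rate_ge0 : 0 <= noise_rate.
Proof. by have [L0 _ _] := hA5; rewrite !mulr_ge0// ltW. Qed.

(** Since 2n+1 <= q0 - 1, the rate 2 noise_rate is at most
    4 (q0 - 1) Lsigma, and (A5) bounds this by 2/5 of a1 - a2. *)
Lemma contraction_rate_gt0 : 0 < contraction_rate.
Proof.
have [L0 + _] := hA5; have [[_ a12 _ _] _] := hA4.
have q1 : 0 < 5 * (2 * q0 - 1) by move: q0_ge1; lra.
rewrite ltr_pdivlMr// => H.
have nq : (2 * n.+1).-1%:R <= q0 - 1.
  move: n_le_q0; rewrite -[X in X%:R <= _](@prednK (2 * n.+1)) ?muln_gt0//.
  by rewrite -natr1; lra.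
have : (2 * n.+1).-1%:R * Lsigma <= (q0 - 1) * Lsigma.
  by rewrite ler_wpM2r// ltW.
rewrite /contraction_rate /noise_rate; lra.
Qed.

Lemma source_ge0 : 0 <= source.
Proof.
have [[_ _ _ C0] _] := hA4.
by rewrite addr_ge0// mulr_ge0// mulr_ge0// sqr_ge0.
Qed.

Lemma rest_level_ge0 : 0 <= rest_level.
Proof. by rewrite divr_ge0 ?source_ge0// ltW// contraction_rate_gt0. Qed.

Variables (N : nat) (Wc : 'I_N.+1 -> T -> pathV R m)
  (X0c : 'I_N.+1 -> T -> borelV R d).
Hypothesis hcopies : iid_copies P (fun w => (W w, X0 w))
  (fun j w => (Wc j w, X0c j w)).
Variables (h : R) (X : nat -> 'I_N.+1 -> T -> borelV R d).
Hypothesis h0 : 0 < h.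
Hypothesis hX : backward_euler P b sigma h Wc X0c X.

Local Notation Xs k i w := (X k i w : 'cV[R]_d).
Local Notation mu k w := (empirical_P2 (fun j => X k j w)).
Local Notation S k w := (N.+1%:R^-1 * \sum_j enorm (Xs k j w) ^+ 2).
Local Notation moment k i := (\int[P]_w ((enorm (Xs k i w) ^+ 2) ^+ n.+1)%:E)%E.

Lemma measurable_sqr_enorm_particle k i :
  measurable_fun setT (fun w => enorm (Xs k i w) ^+ 2).
Proof.
have [mX _ _] := hX.
exact: (measurableT_comp measurable_sqr_enorm (mX k i)).
Qed.

(** The argument of the power is 1 + a1 h times a convex combination of u, s and
    rest_level; apply convexity of the power. *)
Lemma convex_one_step (u s : R) : 0 <= u -> 0 <= s ->
  (u + (2 * n.+1).-1%:R * h * (2 * Lsigma * (u + s)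
     + 2 * hsnorm (sigma 0 (dirac_P2 0)) ^+ 2) + (a2 * h * s + C * h)) ^+ n.+1
  <= (1 + a1 * h) ^+ n.+1 *
     ((1 + noise_rate * h) / (1 + a1 * h) * u ^+ n.+1 +
      ((noise_rate + a2) * h) / (1 + a1 * h) * s ^+ n.+1 +
      (contraction_rate * h) / (1 + a1 * h) * rest_level ^+ n.+1).
Proof.
move=> u0 s0; have [[a20 a12 _ _] _] := hA4.
have D0 : 0 < 1 + a1 * h by rewrite addr_gt0// mulr_gt0//; lra.
have g0 := contraction_rate_gt0.
have l0 := noise_rate_ge0.
set p1 := (1 + noise_rate * h) / (1 + a1 * h).
set p2 := ((noise_rate + a2) * h) / (1 + a1 * h).
set p3 := (contraction_rate * h) / (1 + a1 * h).
have -> : u + (2 * n.+1).-1%:R * h * (2 * Lsigma * (u + s)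
     + 2 * hsnorm (sigma 0 (dirac_P2 0)) ^+ 2) + (a2 * h * s + C * h) =
    (1 + a1 * h) * (p1 * u + p2 * s + p3 * rest_level).
  rewrite /p1 /p2 /p3 /rest_level.
  have Dn : 1 + a1 * h != 0 by rewrite gt_eqF.
  have gn : contraction_rate != 0 by rewrite gt_eqF.
  rewrite [RHS](_ : _ = (1 + noise_rate * h) * u + (noise_rate + a2) * h * s +
    source * h); last by rewrite /source; field; apply/andP; split.
  by rewrite /noise_rate /source; ring.
rewrite exprMn ler_wpM2l ?exprn_ge0 ?(ltW D0)//.
apply: jensen_power3 => //.
- by rewrite divr_ge0 ?(ltW D0)// addr_ge0// mulr_ge0// ltW.
- by rewrite divr_ge0 ?(ltW D0)// mulr_ge0 ?(ltW h0)// addr_ge0.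
- by rewrite divr_ge0 ?(ltW D0)// mulr_ge0 ?(ltW h0)// ltW.
- have Dn : 1 + a1 * h != 0 by rewrite gt_eqF.
  by rewrite /p1 /p2 /p3 /contraction_rate; field.
- exact: rest_level_ge0.
Qed.

(** A bound B above the rest level is invariant. The dissipation of the implicit
    step, the Gaussian estimate for the explicit noise and
    [convex_one_step] bound the new moment by a convex combination of the old
    moments and of the power of the rest level, all of which are at most B. *)
Lemma moment_step k (B : \bar R) :
  (forall j, moment k j <= B)%E -> ((rest_level ^+ n.+1)%:E <= B)%E ->
  forall i, (moment k.+1 i <= B)%E.
Proof.
move=> kB GB i; have [[a20 a12 _ _] _] := hA4.
have D0 : 0 < 1 + a1 * h by rewrite addr_gt0// mulr_gt0//; lra.
have g0 := contraction_rate_gt0.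
have l0 := noise_rate_ge0.
have G0 := rest_level_ge0.
have Dn0 : 0 < (1 + a1 * h) ^+ n.+1 by rewrite exprn_gt0.
have Bge0 : (0 <= B)%E by apply: le_trans GB; rewrite lee_fin exprn_ge0.
pose xi l w := (increment (Wc i) (k%:R * h) (k.+1%:R * h) w : 'cV[R]_m) l ord0.
pose r w := a2 * h * S k w + C * h.
pose sg w := sigma (X k i w) (mu k w).
have mu0 j w : 0 <= enorm (Xs k j w) ^+ 2 by exact: sqr_ge0.
have S0 w : 0 <= S k w by rewrite mulr_ge0// sumr_ge0.
have C0 : 0 <= C by have [[_ _ _ +] _] := hA4.
have r0 w : 0 <= r w.
  by rewrite addr_ge0// mulr_ge0 ?(ltW h0)// mulr_ge0// ltW.
have GM : scheme_past (P := P) F W X0 Wc X0c h k `<=` measurable.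
  exact: copies_past_measurable.
have mX := measurable_particle hF hW hX0 hA1 hA2 hA5 hcopies (ltW h0) hX (k := k).
have mT (f : T -> R) : measurable_fun
    [set: g_sigma_algebraType (scheme_past (P := P) F W X0 Wc X0c h k)] f ->
    measurable_fun [set: T] f.
  move=> mf _ A mA; rewrite setTI; apply: (sigma_generated_measurable GM).
  by have := mf measurableT _ mA; rewrite setTI.
have msg c l := measurable_diffusion_coeff hA5 mX i c l.
have msq j : measurable_fun
    [set: g_sigma_algebraType (scheme_past (P := P) F W X0 Wc X0c h k)]
    (fun w => enorm (Xs k j w) ^+ 2).
  by under eq_fun do rewrite sqr_enorm; exact: measurable_inner.
have mS : measurable_fun
    [set: g_sigma_algebraType (scheme_past (P := P) F W X0 Wc X0c h k)]
    (fun w => S k w).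
  by apply: measurable_funM => //; apply: measurable_sum => j.
have mr : measurable_fun
    [set: g_sigma_algebraType (scheme_past (P := P) F W X0 Wc X0c h k)] r.
  by apply: measurable_funD => //; exact: measurable_funM.
have mxi l : measurable_fun [set: T] (xi l).
  have := measurable_increment_copies hF hW hcopies i l (step_time_ge0 (ltW h0) k)
    (step_time_leS (ltW h0) k).
  move=> mf _ A mA; rewrite setTI.
  apply: (sigma_generated_measurable
    (@copies_past_measurable _ _ _ _ _ P F W X0 N Wc X0c (k.+1%:R * h))).
  by have := mf measurableT _ mA; rewrite setTI.
have sh0 : Num.sqrt h != 0 by rewrite gt_eqF// sqrtr_gt0.
have gauss := @expectation_gaussian_vector _ _ _ P _ d m xi (Num.sqrt h) GM mxi sh0
  (fun A E sA mE => increment_independent hF hW hcopies (ltW h0) i h0 sA mE)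
  (fun w => Xs k i w) sg r n.+1 (mX i) msg mr r0.
rewrite sqr_sqrtr ?(ltW h0)// in gauss.
pose u j w := (enorm (Xs k j w) ^+ 2) ^+ n.+1.
have u0 j w : 0 <= u j w by rewrite exprn_ge0.
have mu' j : measurable_fun setT (u j).
  by apply: measurable_funX; exact: measurable_sqr_enorm_particle.
set D := 1 + a1 * h in D0 Dn0.
pose p1 := (1 + noise_rate * h) / D.
pose p2 := ((noise_rate + a2) * h) / D.
pose p3 := (contraction_rate * h) / D.
have p10 : 0 <= p1 by rewrite divr_ge0 ?(ltW D0)// addr_ge0// mulr_ge0// ltW.
have p20 : 0 <= p2 by rewrite divr_ge0 ?(ltW D0)// mulr_ge0 ?(ltW h0)// addr_ge0.
have p30 : 0 <= p3 by rewrite divr_ge0 ?(ltW D0)// mulr_ge0 ?(ltW h0)// ltW.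
have psum : p1 + p2 + p3 = 1.
  have Dn : 1 + a1 * h != 0 by rewrite gt_eqF.
  by rewrite /p1 /p2 /p3 /contraction_rate /D; field.
(* the mean square shares the weight p2 equally among all particles, and the
   particle i itself carries p1 *)
pose c j := p2 * N.+1%:R^-1 + (if j == i then p1 else 0).
have c0 j : 0 <= c j.
  by rewrite addr_ge0//; [rewrite mulr_ge0|case: (j == i)].
have csum : \sum_j c j + p3 = 1.
  rewrite big_split/= -big_mkcond big_pred1_eq sumr_const card_ord.
  by rewrite -[X in X + _ + _]mulr_natr mulfVK ?pnatr_eq0// [p2 + p1]addrC.
rewrite -(@lee_pmul2l _ (D ^+ n.+1)%:E)//.
rewrite -ge0_integralZl//; last 3 first.
- apply/measurable_EFinP; apply: measurable_funX.
  exact: measurable_sqr_enorm_particle.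
- by move=> w _; rewrite lee_fin exprn_ge0 ?sqr_ge0.
- by rewrite lee_fin ltW.
have mB c' l : measurable_fun [set: T] (fun w => sg w c' l) by exact: mT.
have mxB : measurable_fun [set: T]
    (fun w => enorm (Xs k i w + sg w *m \col_l xi l w) ^+ 2).
  under eq_fun do rewrite sqr_enorm.
  apply: measurable_sum => c'.
  have mc : measurable_fun [set: T]
      (fun w => (Xs k i w + sg w *m \col_l xi l w) c' ord0).
    under eq_fun do rewrite mxE mxE.
    apply: measurable_funD; first by apply: mT; exact: mX.
    apply: measurable_sum => l; apply: measurable_funM => //.
    by apply: eq_measurable_fun (mxi l) => w _; rewrite mxE.
  exact: measurable_funM.
(* dissipation of the implicit step, valid where the scheme holds *)
apply: (@le_trans _ _ (\int[P]_w
    ((enorm (Xs k i w + sg w *m \col_l xi l w) ^+ 2 + r w) ^+ n.+1)%:E)%E).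
  apply: ae_ge0_le_integral => //.
  - move=> w _; rewrite -EFinM lee_fin; apply: mulr_ge0; first exact: ltW.
    by rewrite exprn_ge0 ?sqr_ge0.
  - apply/measurable_EFinP; apply: measurable_funM => //; apply: measurable_funX.
    exact: measurable_sqr_enorm_particle.
  - by move=> w _; rewrite lee_fin exprn_ge0// addr_ge0// sqr_ge0.
  - apply/measurable_EFinP; apply: measurable_funX; apply: measurable_funD => //.
    exact: mT.
  - have [_ _ /(_ k i)] := hX; apply: filterS => w /= eX _.
    rewrite -EFinM lee_fin -exprMn; apply: lerXn2r; rewrite ?nnegrE.
    - by apply: mulr_ge0; [exact: ltW|exact: sqr_ge0].
    - by rewrite addr_ge0// sqr_ge0.
    apply: (implicit_step_dissipation hA4 q0_ge1 (ltW h0)).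
    have -> : \col_l xi l w = increment (Wc i) (k%:R * h) (k.+1%:R * h) w.
      by apply/colP => l; rewrite mxE.
    by rewrite {1}eX [X in X - _]addrAC addrK.
(* the increment is independent of the past, so it can be integrated out *)
apply: (le_trans gauss).
apply: (@le_trans _ _ ((D ^+ n.+1)%:E *
    \int[P]_w (\sum_j c j * u j w + p3 * rest_level ^+ n.+1)%:E)%E); last first.
  rewrite lee_wpmul2l ?lee_fin ?(ltW Dn0)//.
  by apply: integral_convex_combination_le => //; rewrite exprn_ge0.
have mQ : measurable_fun [set: T]
    (fun w => \sum_j c j * u j w + p3 * rest_level ^+ n.+1).
  apply: measurable_funD => //; apply: measurable_sum => j.
  exact: measurable_funM.
have Q0 w : 0 <= \sum_j c j * u j w + p3 * rest_level ^+ n.+1.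
  rewrite addr_ge0//; last by rewrite mulr_ge0// exprn_ge0.
  by apply: sumr_ge0 => j _; rewrite mulr_ge0.
rewrite -ge0_integralZl//; last 3 first.
- exact/measurable_EFinP.
- by move=> w _; rewrite lee_fin.
- by rewrite lee_fin ltW.
have hs0 w : 0 <= (2 * n.+1).-1%:R * h * hsnorm (sg w) ^+ 2.
  by rewrite mulr_ge0 ?sqr_ge0// mulr_ge0// ltW.
apply: ge0_le_integral => //.
- by move=> w _; rewrite lee_fin exprn_ge0// addr_ge0// addr_ge0.
- apply/measurable_EFinP; apply: measurable_funX; apply: measurable_funD.
    exact: mT.
  apply: measurable_funD; last exact: mT.
  apply: measurable_funM => //; under eq_fun do rewrite sqr_hsnorm.
  apply: measurable_sum => l; apply: measurable_sum => c'.
  exact: measurable_funX.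
- by apply/measurable_EFinP; exact: measurable_funM.
move=> w _; rewrite -EFinM lee_fin.
apply: (@le_trans _ _ ((enorm (Xs k i w) ^+ 2 + (2 * n.+1).-1%:R * h *
    (2 * Lsigma * (enorm (Xs k i w) ^+ 2 + S k w)
     + 2 * hsnorm (sigma 0 (dirac_P2 0)) ^+ 2) + (a2 * h * S k w + C * h)) ^+ n.+1)).
  have grow := diffusion_growth hA5 (Xs k i w) (fun j => Xs k j w).
  have kh0 : 0 <= (2 * n.+1).-1%:R * h by rewrite mulr_ge0// ltW.
  have grow' := ler_wpM2l kh0 grow.
  apply: lerXn2r; rewrite ?nnegrE.
  - by rewrite addr_ge0// addr_ge0.
  - apply: addr_ge0; last exact: (r0 w).
    by apply: addr_ge0; [exact: sqr_ge0|exact: le_trans (hs0 w) grow'].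
  - by rewrite addrA lerD2r lerD2l.
apply: (le_trans (convex_one_step (mu0 i w) (S0 w))).
rewrite ler_wpM2l ?(ltW Dn0)// lerD2r.
have Sn : S k w ^+ n.+1 <= \sum_j N.+1%:R^-1 * u j w.
  have := @jensen_power R 'I_N.+1 (fun=> N.+1%:R^-1)
    (fun j => enorm (Xs k j w) ^+ 2) n.
  rewrite -mulr_sumr; apply => //.
  by rewrite sumr_const card_ord -[LHS]mulr_natr mulVf// pnatr_eq0.
have -> : \sum_j c j * u j w = p1 * u i w + p2 * \sum_j N.+1%:R^-1 * u j w.
  rewrite (bigD1 i)//= [in RHS](bigD1 i)//= /c eqxx mulrDr mulr_sumr mulrDl.
  rewrite [in LHS](eq_bigr (fun j => p2 * (N.+1%:R^-1 * u j w))); first by ring.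
  by move=> j /negbTE ->; rewrite addr0 mulrA.
by rewrite lerD2l ler_wpM2l.
Qed.

End moment_propagation.

(** * Initial moments and the uniform bound *)

Lemma ge0_integral_identically_distributed {R : realType} d d'
    (T : measurableType d) (U : measurableType d') (P : probability T R)
    (Y Z : T -> U) (f : U -> \bar R) :
  measurable_fun setT Y -> measurable_fun setT Z ->
  (forall A, measurable A -> P (Y @^-1` A) = P (Z @^-1` A)) ->
  measurable_fun setT f -> (forall z, 0 <= f z)%E ->
  (\int[P]_w f (Y w) = \int[P]_w f (Z w))%E.
Proof.
move=> mY mZ YZ mf f0.
have tr V (mV : measurable_fun setT V) :
    (\int[distribution P (mfun_of mV)]_z f z = \int[P]_w f (V w))%E.
  by rewrite ge0_integral_distribution.
rewrite -(tr _ mY) -(tr _ mZ).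
by apply: eq_measure_integral => A mA _; exact: YZ.
Qed.

Section initial_law.
Context {R : realType} {d m : nat} {disp : measure_display}
  {T : measurableType disp} {P : probability T R}.
Variables (F : R -> set (set T)) (W : T -> pathV R m) (X0 : T -> borelV R d).
Hypothesis hF : complete_filtration P F.
Hypothesis hX0 : F_measurable (F 0) X0.
Variables (N : nat) (Wc : 'I_N.+1 -> T -> pathV R m)
  (X0c : 'I_N.+1 -> T -> borelV R d).
Hypothesis hcopies : iid_copies P (fun w => (W w, X0 w))
  (fun j w => (Wc j w, X0c j w)).

Lemma measurable_initial : measurable_fun setT X0.
Proof.
have [_ /(_ _ (lexx 0))[_ mF0] _ _] := hF.
by move=> _ B mB; rewrite setTI; apply: mF0; exact: hX0.
Qed.

Lemma measurable_initial_copy j : measurable_fun setT (X0c j).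
Proof.
have [/(_ j) mZ _ _] := hcopies.
exact: (measurableT_comp (@measurable_snd _ _ (pathV R m) (borelV R d)) mZ).
Qed.

Lemma integral_initial_copy j (f : borelV R d -> \bar R) :
  measurable_fun setT f -> (forall x, 0 <= f x)%E ->
  (\int[P]_w f (X0c j w) = \int[P]_w f (X0 w))%E.
Proof.
apply: ge0_integral_identically_distributed.
- exact: measurable_initial_copy.
- exact: measurable_initial.
- move=> A mA; have [_ law _] := hcopies.
  have mA' : measurable (snd @^-1` A : set (pathV R m * borelV R d)).
    by rewrite -[_ @^-1` _]setTI; exact: measurable_snd.
  exact: (law j _ mA').
Qed.

End initial_law.

Lemma enorm_powRE {R : realType} {d : nat} (x : 'cV[R]_d) (r : R) :
  enorm x `^ (2 * r) = (enorm x ^+ 2) `^ r.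
Proof. by rewrite powRrM (powR_mulrn 2 (enorm_ge0 x)). Qed.

Lemma measurable_enorm_powR {R : realType} {d : nat} (r : R) :
  measurable_fun [set: borelV R d] (fun x : borelV R d => enorm x `^ (2 * r)).
Proof.
under eq_fun do rewrite enorm_powRE.
exact: (measurableT_comp (measurable_powR r) measurable_sqr_enorm).
Qed.

(** Interpolation between the exponents 0 and s. *)
Lemma powR_le1D {R : realType} (x r s : R) : 0 <= x -> 0 <= r -> r <= s ->
  x `^ r <= 1 + x `^ s.
Proof.
move=> x0 r0 rs; have [x1|/ltW x1] := leP 1 x.
  by apply: (le_trans (ler_powR x1 rs)); rewrite lerDr.
apply: (@le_trans _ _ 1); last by rewrite lerDl powR_ge0.
have -> : 1 = 1 `^ r :> R by rewrite powR1.
by apply: ge0_ler_powR; rewrite ?nnegrE//.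
Qed.

Theorem theorem3p11 (R : realType) (d m : nat)
  (disp : measure_display) (T : measurableType disp) (P : probability T R)
  (F : R -> set (set T)) (W : T -> pathV R m) (X0 : T -> borelV R d)
  (b : 'cV[R]_d -> P2 R d -> 'cV[R]_d)
  (sigma : 'cV[R]_d -> P2 R d -> 'M[R]_(d, m))
  (K1 K2 L1 kappa L2 q0 a1 a2 qstar C Lsigma h0 p : R)
  (hF : complete_filtration P F)
  (hW : brownian_motion P F W)
  (hX0 : F_measurable (F 0) X0)
  (hind : independent P W X0)
  (hA1 : A1 b sigma K1 K2)
  (hA2 : A2 b L1 kappa)
  (hA3 : A3 b P X0 L2 q0)
  (hA4 : A4 b sigma q0 a1 a2 qstar C)
  (hA5 : A5 sigma q0 a1 a2 Lsigma)
  (hh0 : 0 < h0 <= 1)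
  (hp : 1 <= p < (Num.floor (q0 / 2))%:~R) :
  exists K9 : R, 0 < K9 /\
  forall (N : nat) (Wc : 'I_N.+1 -> T -> pathV R m)
    (X0c : 'I_N.+1 -> T -> borelV R d)
    (hcopies : iid_copies P (fun w => (W w, X0 w))
       (fun j w => (Wc j w, X0c j w)))
    (M : nat) (hM : (0 < M)%N) (hstep : M%:R^-1 <= h2 K1 K2 h0 a1 a2 p)
    (X : nat -> 'I_N.+1 -> T -> borelV R d)
    (hX : backward_euler P b sigma M%:R^-1 Wc X0c X) (k : nat),
    (ereal_sup [set 'E_P[fun w => (enorm (X k j w) `^ (2 * p))%R]
                 | j in [set: 'I_N.+1]]
     <= K9%:E * ereal_sup [set 'E_P[fun w => (1 + enorm (X0c j w) `^ (4 * p))%R]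
                            | j in [set: 'I_N.+1]])%E /\
    (K9%:E * ereal_sup [set 'E_P[fun w => (1 + enorm (X0c j w) `^ (4 * p))%R]
                         | j in [set: 'I_N.+1]]
     <= K9%:E * 'E_P[fun w => (1 + enorm (X0 w) `^ (4 * p))%R])%E.
Proof.
have [_ q20 _ _] := hA3; have /andP[p1 pq] := hp.
have q1 : 1 <= q0 by lra.
(* n.+1 is the ceiling of p: at least p and at most 2p because p >= 1, and at
   most q0/2 because p is below the integer part of q0/2 *)
have [n [pn n2p nq]] : exists n : nat,
    [/\ p <= n.+1%:R, n.+1%:R <= 2 * p & (2 * n.+1)%:R <= q0].
  have c0 : 0 < Num.ceil p by rewrite ceil_gt0; lra.
  have cE : Num.ceil p = (absz (Num.ceil p))%:Z by rewrite gez0_abs// ltW.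
  have cN : (0 < absz (Num.ceil p))%N by rewrite absz_gt0 gt_eqF.
  have nE : ((absz (Num.ceil p)).-1.+1)%:R = (Num.ceil p)%:~R :> R.
    by rewrite prednK// [in RHS]cE.
  exists (absz (Num.ceil p)).-1; rewrite natrM nE; split.
  - exact: ceil_ge.
  - by have := ceilB1_lt p; rewrite intrD; lra.
  - have : Num.ceil p <= Num.floor (q0 / 2) by rewrite ceil_le_int ltW.
    by rewrite -(ler_int R); have := floor_le (q0 / 2); lra.
have G0 := rest_level_ge0 hA4 hA5 q1 nq.
set G := rest_level _ _ _ _ _ _ in G0.
have Gn0 : 0 <= G ^+ n.+1 by rewrite exprn_ge0.
(* one unit for |X|^(2p) <= 1 + |X|^(2(n+1)), one for
   |X0|^(2(n+1)) <= 1 + |X0|^(4p), and the power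
   of the rest level *)
exists (2 + G ^+ n.+1); split; first by lra.
move=> N Wc X0c hcopies M hM _ X hX k.
have h_gt0 : 0 < M%:R^-1 :> R by rewrite invr_gt0 ltr0n.
set E0 := ('E_P[fun w => (1 + enorm (X0 w) `^ (4 * p))%R])%E.
pose f (x : borelV R d) : \bar R := (1 + enorm x `^ (4 * p))%:E.
have mf : measurable_fun setT f.
  apply/measurable_EFinP; apply: measurable_funD => //.
  have := measurable_enorm_powR (2 * p).
  by rewrite mulrA -natrM.
have f0 x : (0 <= f x)%E by rewrite lee_fin addr_ge0// powR_ge0.
have EX0c j : ('E_P[fun w => (1 + enorm (X0c j w) `^ (4 * p))%R] = E0)%E.
  rewrite /E0 unlock.
  exact: (integral_initial_copy hF hX0 hcopies j mf f0).
have -> : [set 'E_P[fun w => (1 + enorm (X0c j w) `^ (4 * p))%R]%E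
      | j in [set: 'I_N.+1]] = [set E0].
  apply/seteqP; split => [_ [j _ <-]|_ ->]; first exact: EX0c.
  by exists ord0.
rewrite ereal_sup1; split => //.
pose g (x : borelV R d) : \bar R := ((enorm x ^+ 2) ^+ n.+1)%:E.
have mg : measurable_fun setT g.
  by apply/measurable_EFinP; apply: measurable_funX; exact: measurable_sqr_enorm.
have g0 x : (0 <= g x)%E by rewrite lee_fin exprn_ge0 ?sqr_ge0.
have [mX X0E _] := hX.
have mgX j l : measurable_fun setT (fun w => g (X l j w)).
  exact: (measurableT_comp mg (mX l j)).
have mX0 := measurable_initial hF hX0.
pose B := (\int[P]_w g (X0 w) + (G ^+ n.+1)%:E)%E.
have gB l j : (\int[P]_w g (X l j w) <= B)%E.
  elim: l j => [|l IH] j.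
    apply: (@le_trans _ _ (\int[P]_w g (X0 w))%E).
      rewrite -(integral_initial_copy hF hX0 hcopies j mg g0).
      apply: ae_ge0_le_integral => //.
        exact: (measurableT_comp mg (measurable_initial_copy hcopies j)).
      by apply: filterS (X0E j) => w -> _.
    by rewrite /B leeDl// lee_fin.
  apply: (moment_step hF hW hX0 hA1 hA2 hA4 hA5 q1 nq hcopies h_gt0 hX IH).
  by rewrite /B leeDr// integral_ge0.
have E0ge1 : (1 <= E0)%E.
  rewrite /E0 unlock -[leLHS](_ : (\int[P]_w (cst 1 w) = 1)%E); last first.
    by rewrite integral_cst// mul1e; exact: probability_setT.
  apply: ge0_le_integral => //.
    exact: (measurableT_comp mf mX0).
  by move=> w _; rewrite lee_fin lerDl powR_ge0.
have gE0 : (\int[P]_w g (X0 w) <= E0)%E.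
  rewrite /E0 unlock; apply: ge0_le_integral => //.
  - exact: (measurableT_comp mg mX0).
  - exact: (measurableT_comp mf mX0).
  - move=> w _; rewrite lee_fin.
    have -> : 4 * p = 2 * (2 * p) :> R by rewrite mulrA -natrM.
    rewrite enorm_powRE -(powR_mulrn _ (sqr_ge0 _)).
    by apply: powR_le1D => //; exact: sqr_ge0.
apply: ge_ereal_sup => _ [j _ <-].
apply: (@le_trans _ _ (1 + B)%E).
  apply: (@le_trans _ _ (1 + \int[P]_w g (X k j w))%E); last by rewrite leeD2l.
  rewrite unlock -[X in (X + _)%E](_ : (\int[P]_w (cst 1 w) = 1)%E); last first.
    by rewrite integral_cst// mul1e; exact: probability_setT.
  rewrite -ge0_integralD//; apply: ge0_le_integral => //.
  - by move=> w _; rewrite lee_fin powR_ge0.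
  - apply/measurable_EFinP.
    exact: (measurableT_comp (measurable_enorm_powR p) (mX k j)).
  - exact: emeasurable_funD.
  - move=> w _; rewrite /g/= -EFinD lee_fin enorm_powRE -(powR_mulrn _ (sqr_ge0 _)).
    by apply: powR_le1D; rewrite ?sqr_ge0//; lra.
rewrite EFinD ge0_muleDl ?lee_fin// (_ : 2%:E = (1 + 1)%E)//.
rewrite ge0_muleDl// !mul1e -addeA; apply: leeD => //; apply: leeD => //.
by rewrite lee_pemulr// lee_fin.
Qed.
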